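(* Let $(\mathcal{X}_0,\mathcal{X}_1)$ be a compatible couple of sequentially structured Banach spaces and let $s,t\in\mathbb{S}$. Then $$d_K(\mathcal{X}_t^{(2)},\mathcal{X}_s^{(2)})\le 4\,|e^t-e^s|\max\{C_s,C_t\}.$$
   Context: All Banach spaces are complex. For a Banach space $X$, $\ell^0(\mathbb{Z};X)$ is the space of all $X$-valued sequences indexed by $\mathbb{Z}$. A sequence structure on $X$ is a Banach space $\mathfrak{S}\subset\ell^0(\mathbb{Z};X)$ which is translation invariant ($\|(x_{k+n})_k\|_{\mathfrak{S}}=\|(x_k)_k\|_{\mathfrak{S}}$ for all $n\in\mathbb{Z}$) and for which the inclusions $\ell^1(\mathbb{Z};X)\subset\mathfrak{S}\subset\ell^\infty(\mathbb{Z};X)$ have norm $1$; $\mathcal{X}=[X,\mathfrak{S}]$ is then a sequentially structured Banach space. For $a\in\mathbb{C}\setminus\{0\}$, $\mathfrak{S}(a)$ is the space of $\vec{x}\in\ell^0(\mathbb{Z};X)$ with $\|\vec{x}\|_{\mathfrak{S}(a)}=\|(a^kx_k)_k\|_{\mathfrak{S}}<\infty$. A compatible couple of sequentially structured Banach spaces is $(\mathcal{X}_0,\mathcal{X}_1)$ with $\mathcal{X}_j=[X_j,\mathfrak{S}_j]$ and $(X_0,X_1)$ a compatible couple of Banach spaces. Let $\mathbb{S}=\{z\in\mathbb{C}:0<\operatorname{Re}z<1\}$. For $z\in\mathbb{S}$ and $x\in X_0+X_1$ let $\|x\|_{z,2}=\inf(\|\vec{x}\|_{\mathfrak{S}_0(e^{-z})}^2+\|\vec{x}\|_{\mathfrak{S}_1(e^{1-z})}^2)^{1/2}$,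 the infimum over all $\vec{x}=(x_k)\in\mathfrak{S}_0(e^{-z})\cap\mathfrak{S}_1(e^{1-z})$ with $x=\sum_{k\in\mathbb{Z}}x_k$ in $X_0+X_1$. Then $\mathcal{X}_z^{(2)}=\{x\in X_0+X_1:\|x\|_{z,2}<\infty\}$ with norm $\|\cdot\|_{z,2}$. $\mathcal{H}^2_\pi(\mathbb{S},\mathcal{X}_0,\mathcal{X}_1)$ is the space of analytic $f:\mathbb{S}\to X_0+X_1$ with $f(z+2\pi i)=f(z)$ for all $z$ and $\|f\|_{\mathcal{H}^2_\pi}=(\|\hat f_{z_0}\|_{\mathfrak{S}_0(e^{-z_0})}^2+\|\hat f_{z_0}\|_{\mathfrak{S}_1(e^{1-z_0})}^2)^{1/2}<\infty$, where $\hat f_{z_0}(k)=\frac1{2\pi}\int_0^{2\pi}f(z_0+it)e^{-ikt}\,dt$; this norm does not depend on the choice of $z_0\in\mathbb{S}$. For $s\in\mathbb{S}$, $\delta_s(f)=f(s)$ on this space. For $s\in\mathbb{S}$, $C_s>0$ denotes a constant such that for every $f\in\ker\delta_s$ the function $g(z)=\frac{f(z)}{e^z-e^s}$ satisfies $\|g\|_{\mathcal{H}^2_\pi}\le C_s\|f\|_{\mathcal{H}^2_\pi}$ (such a constant exists). The Kadets distance $d_K(X,Y)$ between Banach spaces $X$ and $Y$ is the infimum, over all Banach spaces $Z$ and all linear isometric embeddings of $X$ and $Y$ into $Z$, of the Hausdorff distance in $Z$ between (the images of) the closed unit balls $B_X$ and $B_Y$. *)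

(* Defs.v *)
From HB Require Import structures.
From mathcomp Require Import all_boot all_order all_algebra.
From mathcomp Require Import complex.
From mathcomp Require Import all_classical all_reals all_analysis.

Set Implicit Arguments.
Unset Strict Implicit.
Unset Printing Implicit Defensive.

Import Order.TTheory GRing.Theory Num.Theory.
Import numFieldNormedType.Exports.

Local Open Scope classical_set_scope.
Local Open Scope ring_scope.
Local Open Scope complex_scope.

(* In a complex normed space the norm `|x| is an element of R[i] with zero
   imaginary part; [rnorm x] is the same number as an element of R. *)
Definition rnorm (R : realType) (V : normedZmodType R[i]) (x : V) : R :=
  complex.Re `|x|.

Section RnormTheory.
Variables (R : realType) (V : normedModType R[i]).
Implicit Types x y : V.

Lemma rnormE x : (rnorm x)%:C = `|x|.
Proof. by rewrite /rnorm RRe_real// normr_real. Qed.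

Lemma rnorm_ge0 x : 0 <= rnorm x.
Proof. by rewrite -lecR rnormE normr_ge0. Qed.

Lemma rnorm0 : rnorm (0 : V) = 0.
Proof. by rewrite /rnorm normr0. Qed.

Lemma rnorm_eq0 x : rnorm x = 0 -> x = 0.
Proof. by move=> x0; apply/normr0_eq0; rewrite -rnormE x0. Qed.

Lemma rnormD x y : rnorm (x + y) <= rnorm x + rnorm y.
Proof. by rewrite -lecR rmorphD/= !rnormE ler_normD. Qed.

Lemma rnormN x : rnorm (- x) = rnorm x.
Proof. by rewrite /rnorm normrN. Qed.

Lemma rnormZ (a : R[i]) x : rnorm (a *: x) = rnorm a * rnorm x.
Proof.
by apply: complexI; rewrite rmorphM/= !rnormE normrZ.
Qed.

End RnormTheory.

Definition cexp (R : realType) (z : R[i]) : R[i] :=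
  (expR (complex.Re z))%:C * (cos (complex.Im z) +i* sin (complex.Im z)).

Lemma rnorm_cexp (R : realType) (z : R[i]) :
  rnorm (cexp z) = expR (complex.Re z).
Proof.
apply: complexI; rewrite (rnormE (cexp z : R[i]^o)) /= /cexp normrM.
by rewrite [X in _ * X]normc_def/= cos2Dsin2 sqrtr1 mulr1 normc_def/= expr0n
  /= addr0 sqrtr_sqr ger0_norm ?expR_ge0.
Qed.

Definition in_strip (R : realType) (z : R[i]) : Prop :=
  0 < complex.Re z < 1.

Record strip (R : realType) := Strip {
  strip_val :> R[i];
  stripP : in_strip strip_val }.

(* Compatibility is witnessed by a Hausdorff topological vector space into
   which both Banach spaces embed continuously. *)
Record compatible_couple (R : realType) := CompatibleCouple {
  cc_X0 : completeNormedModType R[i];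
  cc_X1 : completeNormedModType R[i];
  cc_V : topologicalLmodType R[i];
  cc_V_hausdorff : hausdorff_space cc_V;
  cc_i0 : {linear cc_X0 -> cc_V};
  cc_i1 : {linear cc_X1 -> cc_V};
  cc_i0_inj : injective cc_i0;
  cc_i1_inj : injective cc_i1;
  cc_i0_cont : continuous cc_i0;
  cc_i1_cont : continuous cc_i1 }.

Section SumSpace.
Variables (R : realType) (XX : compatible_couple R).

Definition sum_pred : {pred cc_V XX} :=
  fun v => `[< exists x0 x1, v = cc_i0 XX x0 + cc_i1 XX x1 >].

Record sumsp := SumSp { sum_val : cc_V XX; sum_valP : sum_val \in sum_pred }.

HB.instance Definition _ := [isSub for sum_val].
HB.instance Definition _ := [Choice of sumsp by <:].

Lemma sum_pred_closed : submod_closed sum_pred.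
Proof.
split=> [|a u v]; rewrite !unfold_in.
  by apply/asboolP; exists 0, 0; rewrite !linear0 addr0.
move=> /asboolP[u0 [u1 ->]] /asboolP[v0 [v1 ->]]; apply/asboolP.
by exists (a *: u0 + v0), (a *: u1 + v1); rewrite !linearP scalerDr addrACA.
Qed.

HB.instance Definition _ :=
  GRing.isSubmodClosed.Build _ _ sum_pred sum_pred_closed.
HB.instance Definition _ := [SubChoice_isSubLmodule of sumsp by <:].

Definition sum_norm (x : sumsp) : R :=
  inf [set r | exists x0 x1, sum_val x = cc_i0 XX x0 + cc_i1 XX x1 /\
                             r = rnorm x0 + rnorm x1].

Lemma sum_norm_set_has_inf (x : sumsp) :
  has_inf [set r | exists x0 x1, sum_val x = cc_i0 XX x0 + cc_i1 XX x1 /\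
                             r = rnorm x0 + rnorm x1].
Proof.
split.
  case: x => v vP /=; move: (vP); rewrite unfold_in => /asboolP[x0 [x1 E]].
  by exists (rnorm x0 + rnorm x1), x0, x1.
by exists 0 => _ [x0 [x1 [_ ->]]]; rewrite addr_ge0 ?rnorm_ge0.
Qed.

Lemma sum_norm_le (x : sumsp) x0 x1 :
  sum_val x = cc_i0 XX x0 + cc_i1 XX x1 -> sum_norm x <= rnorm x0 + rnorm x1.
Proof.
move=> E; apply: ge_inf; first by case: (sum_norm_set_has_inf x).
by exists x0, x1.
Qed.

Lemma sum_norm_adherent (x : sumsp) (e : R) : 0 < e ->
  exists x0 x1, sum_val x = cc_i0 XX x0 + cc_i1 XX x1 /\
                rnorm x0 + rnorm x1 < sum_norm x + e.
Proof.
move=> e0; have [_ [x0 [x1 [E ->]]] lt] :=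
  inf_adherent e0 (sum_norm_set_has_inf x).
by exists x0, x1.
Qed.

Lemma sum_norm_ge0 (x : sumsp) : 0 <= sum_norm x.
Proof.
apply: lb_le_inf; first by case: (sum_norm_set_has_inf x).
by move=> _ [x0 [x1 [_ ->]]]; rewrite addr_ge0 ?rnorm_ge0.
Qed.

Lemma sum_norm_D (x y : sumsp) :
  (sum_norm (x + y))%:C <= (sum_norm x)%:C + (sum_norm y)%:C.
Proof.
rewrite -rmorphD/= lecR; apply/ler_addgt0Pr => e e0.
have e20 : 0 < e / 2 by rewrite divr_gt0.
have [x0 [x1 [Ex ltx]]] := sum_norm_adherent x e20.
have [y0 [y1 [Ey lty]]] := sum_norm_adherent y e20.
have Exy : sum_val (x + y) = cc_i0 XX (x0 + y0) + cc_i1 XX (x1 + y1).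
  by rewrite [LHS](_ : _ = sum_val x + sum_val y)// Ex Ey !linearD/= addrACA.
apply: (le_trans (sum_norm_le Exy)).
apply: (le_trans (lerD (rnormD _ _) (rnormD _ _))).
by rewrite addrACA [e]splitr [leRHS]addrACA lerD// ltW.
Qed.

Lemma sum_norm_Z_le (a : R[i]) (x : sumsp) :
  sum_norm (a *: x) <= rnorm a * sum_norm x.
Proof.
have a0 : 0 <= rnorm a by exact: (rnorm_ge0 (a : R[i]^o)).
apply/ler_addgt0Pr => e e0.
have d0 : 0 < e / (rnorm a + 1) by rewrite divr_gt0// ltr_wpDl.
have [x0 [x1 [Ex ltx]]] := sum_norm_adherent x d0.
have Eax : sum_val (a *: x) = cc_i0 XX (a *: x0) + cc_i1 XX (a *: x1).
  by rewrite !linearZ/= -scalerDr -Ex.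
apply: (le_trans (sum_norm_le Eax)).
rewrite !rnormZ -mulrDr.
apply: (le_trans (ler_wpM2l a0 (ltW ltx))).
rewrite mulrDr lerD2l mulrCA ler_piMr// ?(ltW e0)//.
by rewrite ler_pdivrMr ?ltr_wpDl// mul1r lerDl.
Qed.

Lemma sum_norm_Z (a : R[i]) (x : sumsp) :
  (sum_norm (a *: x))%:C = `|a| * (sum_norm x)%:C.
Proof.
rewrite -(rnormE (a : R[i]^o)) -rmorphM/=; congr (_ %:C).
apply/eqP; rewrite eq_le sum_norm_Z_le/=.
have [->|a0] := eqVneq a 0.
  by rewrite (rnorm0 R[i]^o) mul0r sum_norm_ge0.
have a0' : rnorm (a : R[i]^o) != 0.
  by apply: contra_neq a0 => /rnorm_eq0.
have := sum_norm_Z_le a^-1 (a *: x).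
rewrite scalerA mulVf// scale1r => le.
apply: (le_trans (ler_wpM2l (rnorm_ge0 (a : R[i]^o)) le)).
rewrite mulrA -(rnormZ a (a^-1 : R[i]^o)) /GRing.scale/= mulfV//.
by rewrite /rnorm normr1/= mul1r.
Qed.

(* A nonzero element of norm 0 would be a limit of elements both of whose
   components tend to 0, against the Hausdorff property. *)
Lemma sum_norm_eq0 (x : sumsp) : (sum_norm x)%:C = 0 -> x = 0.
Proof.
move=> /complexI x0; apply: val_inj => /=.
have H n : exists p : cc_X0 XX * cc_X1 XX,
    sum_val x = cc_i0 XX p.1 + cc_i1 XX p.2 /\
    rnorm p.1 + rnorm p.2 < n.+1%:R^-1.
  have n0 : 0 < n.+1%:R^-1 :> R by rewrite invr_gt0.
  have [y0 [y1 [E lt]]] := sum_norm_adherent x n0.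
  by exists (y0, y1); split=> //; rewrite x0 add0r in lt.
have {}[p pP] := choice H.
have cvg0 (X : normedModType R[i]) (q : nat -> X) :
    (forall n, rnorm (q n) < n.+1%:R^-1) -> q @ \oo --> (0 : X).
  move=> qlt; apply/cvgrPdist_lt => e e0.
  have [r Er] : exists r : R, e = r%:C.
    by apply/complex_realP; rewrite gtr0_real.
  rewrite Er in e0 *; rewrite ltcR in e0.
  near=> n; rewrite sub0r normrN -rnormE ltcR.
  apply: (lt_trans (qlt n)).
  near: n; exact: near_infty_natSinv_lt (PosNum e0).
have p0 : (fun n => (p n).1) @ \oo --> (0 : cc_X0 XX).
  apply: cvg0 => n; have [_] := pP n; apply: le_lt_trans.
  by rewrite lerDl rnorm_ge0.
have p1 : (fun n => (p n).2) @ \oo --> (0 : cc_X1 XX).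
  apply: cvg0 => n; have [_] := pP n; apply: le_lt_trans.
  by rewrite lerDr rnorm_ge0.
have i0 : (fun n => cc_i0 XX (p n).1) @ \oo --> (0 : cc_V XX).
  by rewrite -(linear0 (cc_i0 XX)); apply: continuous_cvg => //;
    exact: cc_i0_cont.
have i1 : (fun n => cc_i1 XX (p n).2) @ \oo --> (0 : cc_V XX).
  by rewrite -(linear0 (cc_i1 XX)); apply: continuous_cvg => //;
    exact: cc_i1_cont.
have s : (fun n => cc_i0 XX (p n).1 + cc_i1 XX (p n).2) @ \oo
    --> (0 + 0 : cc_V XX).
  have h := @add_continuous (cc_V XX) (0, 0).
  exact: (@continuous2_cvg _ _ _ _ _ _ _ _ (fun a b => a + b) _ _ h i0 i1).
have c : (fun n : nat => sum_val x) @ \oo --> (0 + 0 : cc_V XX).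
  rewrite (_ : (fun=> _) = (fun n => cc_i0 XX (p n).1 + cc_i1 XX (p n).2))//.
  by apply/funext => n; have [] := pP n.
rewrite addr0 in c.
have c' : (fun n : nat => sum_val x) @ \oo --> sum_val x by exact: cvg_cst.
exact: (cvg_unique (@cc_V_hausdorff _ XX) c' c).
Unshelve. all: by end_near. Qed.

HB.instance Definition _ :=
  Lmodule_isNormed.Build R[i] sumsp sum_norm_D sum_norm_Z sum_norm_eq0.

Lemma in0_subproof (x : cc_X0 XX) : cc_i0 XX x \in sum_pred.
Proof.
by rewrite unfold_in; apply/asboolP; exists x, 0; rewrite linear0 addr0.
Qed.

Lemma in1_subproof (x : cc_X1 XX) : cc_i1 XX x \in sum_pred.
Proof.
by rewrite unfold_in; apply/asboolP; exists 0, x; rewrite linear0 add0r.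
Qed.

Definition in0 (x : cc_X0 XX) : sumsp := SumSp (in0_subproof x).
Definition in1 (x : cc_X1 XX) : sumsp := SumSp (in1_subproof x).

Lemma in0_linear : linear in0.
Proof. by move=> a x y; apply: val_inj; rewrite /= linearP. Qed.

Lemma in1_linear : linear in1.
Proof. by move=> a x y; apply: val_inj; rewrite /= linearP. Qed.

HB.instance Definition _ :=
  GRing.isLinear.Build R[i] (cc_X0 XX) sumsp _ in0 in0_linear.
HB.instance Definition _ :=
  GRing.isLinear.Build R[i] (cc_X1 XX) sumsp _ in1 in1_linear.

Lemma in0_inj : injective in0.
Proof. by move=> x y /(congr1 sum_val)/=; exact: cc_i0_inj. Qed.

Lemma in1_inj : injective in1.
Proof. by move=> x y /(congr1 sum_val)/=; exact: cc_i1_inj. Qed.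

Lemma rnorm_in0 x : rnorm (in0 x) <= rnorm x.
Proof.
rewrite [leLHS](_ : _ = sum_norm (in0 x))// -[leRHS]addr0 -(rnorm0 (cc_X1 XX)).
by apply: sum_norm_le; rewrite linear0 addr0.
Qed.

Lemma rnorm_in1 x : rnorm (in1 x) <= rnorm x.
Proof.
rewrite [leLHS](_ : _ = sum_norm (in1 x))// -[leRHS]add0r -(rnorm0 (cc_X0 XX)).
by apply: sum_norm_le; rewrite linear0 add0r.
Qed.

End SumSpace.

Section SeqStructure.
Variables (R : realType) (X : completeNormedModType R[i]).

(* For a Banach space [S] with a map [val] into X-valued sequences, the norm of
   [S] extended by +oo to all sequences (the infimum of the empty set is +oo).
   For injective [val] the infimum is over at most one point. *)
Definition emb_norm (S : completeNormedModType R[i]) (val : S -> int -> X)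
    (x : int -> X) : \bar R :=
  ereal_inf [set (rnorm u)%:E | u in [set u | val u = x]].

Record seq_structure := SeqStructure {
  ss_sp : completeNormedModType R[i];
  ss_val : {linear ss_sp -> (int -> X)};
  ss_inj : injective ss_val;
  ss_shift : forall (x : int -> X) (n : int),
    emb_norm ss_val (fun k => x (k + n)) = emb_norm ss_val x;
  ss_l1 : forall x : int -> X,
    (emb_norm ss_val x <= \esum_(k in [set: int]) (rnorm (x k))%:E)%E;
  ss_linfty : forall x : int -> X,
    (ereal_sup (range (fun k => (rnorm (x k))%:E)) <= emb_norm ss_val x)%E }.

Definition seq_norm (S : seq_structure) : (int -> X) -> \bar R :=
  emb_norm (ss_val S).

Lemma seq_norm_val (S : seq_structure) (u : ss_sp S) :
  seq_norm S (ss_val S u) = (rnorm u)%:E.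
Proof.
rewrite /seq_norm /emb_norm (_ : [set _ | _ in _] = [set (rnorm u)%:E]).
  by rewrite ereal_inf1.
apply/seteqP; split=> [_ [v /= /ss_inj -> <-]//|_ ->].
by exists u.
Qed.

Lemma rnorm_ss_val (S : seq_structure) (u : ss_sp S) (k : int) :
  rnorm (ss_val S u k) <= rnorm u.
Proof.
rewrite -lee_fin -(seq_norm_val u).
apply: (le_trans _ (ss_linfty S (ss_val S u))).
by apply: ereal_sup_ubound; exists k.
Qed.

(* The norm of the weighted space S(a) on sequences in a space W containing X
   through [inc]; it is +oo for a sequence that does not lie in X, and [y] is
   unique when [inc] is injective. *)
Definition wseq_norm (S : seq_structure) (W : normedModType R[i])
    (inc : X -> W) (a : R[i]) (x : int -> W) : \bar R :=
  ereal_inf [set seq_norm S (fun k => a ^ k *: y k) |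
             y in [set y | forall k, inc (y k) = x k]].

Section WeightedTheory.
Variables (S : seq_structure) (W : normedModType R[i]).
Variables (inc : {linear X -> W}) (inc_inj : injective inc).
Hypothesis rnorm_inc : forall x, rnorm (inc x) <= rnorm x.
Variable a : R[i].

Definition wrep (x : int -> W) (u : ss_sp S) : Prop :=
  exists y : int -> X, ss_val S u = (fun k => a ^ k *: y k) /\
                       forall k, inc (y k) = x k.

Lemma wseq_norm_rep x u : wrep x u -> wseq_norm S inc a x = (rnorm u)%:E.
Proof.
move=> [y [uy yx]]; rewrite /wseq_norm.
rewrite (_ : [set _ | _ in _] = [set (rnorm u)%:E]) ?ereal_inf1//.
apply/seteqP; split=> [_ [y' /= y'x <-]|_ ->] /=.
  rewrite (_ : y' = y) -?uy ?seq_norm_val//.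
  by apply/funext => k; apply: inc_inj; rewrite yx y'x.
by exists y; rewrite // -uy seq_norm_val.
Qed.

Lemma wseq_norm_lty x : (wseq_norm S inc a x < +oo)%E -> exists u, wrep x u.
Proof.
move=> /ereal_inf_lt[_ [y /= yx <-]] /ereal_inf_lt[_ [u /= uy _] _].
by exists u, y.
Qed.

Lemma wseq_norm_ge0 x : (0 <= wseq_norm S inc a x)%E.
Proof.
apply/ereal_infP => _ [y _ <-]; apply/ereal_infP => _ [u _ <-].
by rewrite lee_fin rnorm_ge0.
Qed.

Lemma wrepD x x' u u' :
  wrep x u -> wrep x' u' -> wrep (fun k => x k + x' k) (u + u').
Proof.
move=> [y [uy yx]] [y' [uy' yx']]; exists (fun k => y k + y' k); split.
  by rewrite linearD uy uy'; apply/funext => k; rewrite scalerDr.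
by move=> k; rewrite linearD yx yx'.
Qed.

Lemma wrepZ c x u : wrep x u -> wrep (fun k => c *: x k) (c *: u).
Proof.
move=> [y [uy yx]]; exists (fun k => c *: y k); split.
  by rewrite linearZ/= uy; apply/funext => k; rewrite [RHS]scalerA mulrC -scalerA.
by move=> k; rewrite linearZ/= yx.
Qed.

Lemma wrep_bound x u k : wrep x u -> rnorm (a ^ k) * rnorm (x k) <= rnorm u.
Proof.
move=> [y [uy yx]]; rewrite -yx.
apply: le_trans (rnorm_ss_val u k); rewrite uy rnormZ.
by rewrite ler_wpM2l ?rnorm_inc// (rnorm_ge0 (a ^ k : R[i]^o)).
Qed.

End WeightedTheory.

End SeqStructure.

Record seq_couple (R : realType) := SeqCouple {
  sc_couple :> compatible_couple R;
  sc_S0 : seq_structure (cc_X0 sc_couple);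
  sc_S1 : seq_structure (cc_X1 sc_couple) }.

(* The bilateral series of the x_k converges to w. *)
Definition has_sum (R : realType) (W : normedModType R[i])
    (x : int -> W) (w : W) : Prop :=
  exists u v : W,
    [/\ (\sum_(0 <= j < n) x (j%:Z)) @[n --> \oo] --> u,
        (\sum_(0 <= j < n) x (- (j.+1)%:Z)) @[n --> \oo] --> v &
        w = u + v].

Section Interpolation.
Variables (R : realType) (XX : seq_couple R).

Definition couple_norm (z : R[i]) (x : int -> sumsp XX) : \bar R :=
  sqrte (wseq_norm (sc_S0 XX) (@in0 R XX) (cexp (- z)%R) x ^+ 2 +
         wseq_norm (sc_S1 XX) (@in1 R XX) (cexp (1 - z)%R) x ^+ 2)%E.

Definition interp_norm (z : R[i]) (w : sumsp XX) : \bar R :=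
  ereal_inf [set couple_norm z x | x in [set x | has_sum x w]].

Section InterpTheory.
Variable z : R[i].
Local Notation rep0 := (wrep (S := sc_S0 XX) (@in0 R XX) (cexp (- z))).
Local Notation rep1 := (wrep (S := sc_S1 XX) (@in1 R XX) (cexp (1 - z))).

Definition l2 (b c : R) : R := Num.sqrt (b ^+ 2 + c ^+ 2).

Lemma l2E b c : (l2 b c)%:C = `|b +i* c|.
Proof. by rewrite normc_def. Qed.

Lemma l2D b c b' c' : l2 (b + b') (c + c') <= l2 b c + l2 b' c'.
Proof. by rewrite -lecR rmorphD/= !l2E; exact: (ler_normD (b +i* c) (b' +i* c')). Qed.

Lemma l2_le b c b' c' : 0 <= b <= b' -> 0 <= c <= c' -> l2 b c <= l2 b' c'.
Proof.
move=> /andP[b0 bb'] /andP[c0 cc']; rewrite ler_wsqrtr// lerD//.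
  by rewrite lerXn2r// nnegrE (le_trans b0).
by rewrite lerXn2r// nnegrE (le_trans c0).
Qed.

Lemma l2Z r b c : 0 <= r -> l2 (r * b) (r * c) = r * l2 b c.
Proof.
by move=> r0; rewrite /l2 !exprMn -mulrDr sqrtrM ?sqr_ge0// sqrtr_sqr ger0_norm.
Qed.

Lemma le_l2_l b c : b <= l2 b c.
Proof.
apply: (le_trans (ler_norm b)).
by rewrite -sqrtr_sqr ler_wsqrtr// lerDl sqr_ge0.
Qed.

Lemma le_l2_r b c : c <= l2 b c.
Proof.
apply: (le_trans (ler_norm c)).
by rewrite -sqrtr_sqr ler_wsqrtr// lerDr sqr_ge0.
Qed.

Lemma couple_norm_rep x u0 u1 : rep0 x u0 -> rep1 x u1 ->
  couple_norm z x = (l2 (rnorm u0) (rnorm u1))%:E.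
Proof.
move=> x0 x1; rewrite /couple_norm.
rewrite (wseq_norm_rep (@in0_inj R XX) x0).
by rewrite (wseq_norm_rep (@in1_inj R XX) x1).
Qed.

Lemma couple_norm_lty x : (couple_norm z x < +oo)%E ->
  exists u0 u1, rep0 x u0 /\ rep1 x u1.
Proof.
rewrite /couple_norm.
set A := wseq_norm _ _ _ _; set B := wseq_norm _ _ _ _.
have A0 : (0 <= A)%E by exact: wseq_norm_ge0.
have B0 : (0 <= B)%E by exact: wseq_norm_ge0.
move=> AB; have yy : (+oo ^+ 2 = +oo :> \bar R)%E by rewrite expe2 mulyy.
have [u0 r0] : exists u0, rep0 x u0.
  apply: wseq_norm_lty; rewrite -/A.
  rewrite ltey; apply/eqP => Ay; move: AB.
  rewrite Ay yy addye//.
  by rewrite -ltNye (lt_le_trans ltNy0)// expe_ge0.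
have [u1 r1] : exists u1, rep1 x u1.
  apply: wseq_norm_lty; rewrite -/B.
  rewrite ltey; apply/eqP => By; move: AB.
  rewrite By yy addey//.
  by rewrite -ltNye (lt_le_trans ltNy0)// expe_ge0.
by exists u0, u1.
Qed.

Lemma interp_norm_le x w u0 u1 : has_sum x w -> rep0 x u0 -> rep1 x u1 ->
  (interp_norm z w <= (l2 (rnorm u0) (rnorm u1))%:E)%E.
Proof.
move=> xw x0 x1; rewrite -(couple_norm_rep x0 x1).
by apply: ereal_inf_lbound; exists x.
Qed.

Lemma interp_norm_lt w (e : \bar R) : (interp_norm z w < e)%E ->
  exists x u0 u1, [/\ has_sum x w, rep0 x u0, rep1 x u1 &
                      ((l2 (rnorm u0) (rnorm u1))%:E < e)%E].
Proof.
move=> /ereal_inf_lt[_ [x /= xw <-] lt].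
have [u0 [u1 [r0 r1]]] := couple_norm_lty (lt_le_trans lt (leey _)).
by exists x, u0, u1; rewrite -(couple_norm_rep r0 r1).
Qed.

Lemma interp_norm_ge0 w : (0 <= interp_norm z w)%E.
Proof.
apply/ereal_infP => _ [x _ <-]; exact: sqrte_ge0.
Qed.

Lemma has_sumD (x y : int -> sumsp XX) v w :
  has_sum x v -> has_sum y w -> has_sum (fun k => x k + y k) (v + w).
Proof.
move=> [v1 [v2 [c1 c2 ->]]] [w1 [w2 [d1 d2 ->]]].
exists (v1 + w1), (v2 + w2); split; last by rewrite addrACA.
  by under eq_fun do rewrite big_split/=; exact: cvgD.
by under eq_fun do rewrite big_split/=; exact: cvgD.
Qed.

Lemma has_sumZ a (x : int -> sumsp XX) v :
  has_sum x v -> has_sum (fun k => a *: x k) (a *: v).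
Proof.
move=> [v1 [v2 [c1 c2 ->]]].
exists (a *: v1), (a *: v2); split; last by rewrite scalerDr.
  by under eq_fun do rewrite -scaler_sumr; exact: cvgZl_tmp.
by under eq_fun do rewrite -scaler_sumr; exact: cvgZl_tmp.
Qed.

Lemma has_sum0 : has_sum (fun=> 0 : sumsp XX) 0.
Proof.
exists 0, 0; split; rewrite ?addr0//.
  by under eq_fun do rewrite big1//; exact: cvg_cst.
by under eq_fun do rewrite big1//; exact: cvg_cst.
Qed.

Definition interp_pred : {pred sumsp XX} :=
  fun w => (interp_norm z w < +oo)%E.

Lemma interp_norm_D v w :
  (interp_norm z (v + w)%R <= interp_norm z v + interp_norm z w)%E.
Proof.
have [vy|] := ltP (interp_norm z v) +oo%E; last first.
  rewrite leye_eq => /eqP ->.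
  by rewrite addye ?leey// gt_eqF// (lt_le_trans _ (interp_norm_ge0 w)).
have [wy|] := ltP (interp_norm z w) +oo%E; last first.
  rewrite leye_eq => /eqP ->.
  by rewrite addey ?leey// gt_eqF// (lt_le_trans _ (interp_norm_ge0 v)).
have vf : interp_norm z v \is a fin_num by rewrite ge0_fin_numE// interp_norm_ge0.
have wf : interp_norm z w \is a fin_num by rewrite ge0_fin_numE// interp_norm_ge0.
apply/lee_addgt0Pr => e e0.
have e20 : 0 < e / 2 by rewrite divr_gt0.
have [x [u0 [u1 [xv x0 x1 xlt]]]] :
    exists x u0 u1, [/\ has_sum x v, rep0 x u0, rep1 x u1 &
      ((l2 (rnorm u0) (rnorm u1))%:E < interp_norm z v + (e / 2)%:E)%E].
  by apply: interp_norm_lt; rewrite lteDl.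
have [y [v0 [v1 [yw y0 y1 ylt]]]] :
    exists x u0 u1, [/\ has_sum x w, rep0 x u0, rep1 x u1 &
      ((l2 (rnorm u0) (rnorm u1))%:E < interp_norm z w + (e / 2)%:E)%E].
  by apply: interp_norm_lt; rewrite lteDl.
apply: (le_trans (interp_norm_le (has_sumD xv yw) (wrepD x0 y0) (wrepD x1 y1))).
rewrite [e]splitr EFinD addeACA.
apply: (le_trans _ (leeD (ltW xlt) (ltW ylt))).
rewrite -EFinD lee_fin; apply: le_trans (l2D _ _ _ _).
by apply: l2_le; rewrite rnorm_ge0 rnormD.
Qed.

Lemma interp_norm_Z_le a w : interp_pred w ->
  (interp_norm z (a *: w)%R <= (rnorm a)%:E * interp_norm z w)%E.
Proof.
move=> wy.
have wf : interp_norm z w \is a fin_num by rewrite ge0_fin_numE// interp_norm_ge0.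
have a0 : 0 <= rnorm a by exact: (rnorm_ge0 (a : R[i]^o)).
apply/lee_addgt0Pr => e e0.
have d0 : 0 < e / (rnorm a + 1) by rewrite divr_gt0// ltr_wpDl.
have [x [u0 [u1 [xw x0 x1 xlt]]]] :
    exists x u0 u1, [/\ has_sum x w, rep0 x u0, rep1 x u1 &
      ((l2 (rnorm u0) (rnorm u1))%:E
         < interp_norm z w + (e / (rnorm a + 1))%:E)%E].
  by apply: interp_norm_lt; rewrite lteDl.
apply: (le_trans (interp_norm_le (has_sumZ a xw) (wrepZ a x0) (wrepZ a x1))).
rewrite !rnormZ l2Z// EFinM.
apply: (le_trans (lee_wpmul2l _ (ltW xlt))); first by rewrite lee_fin.
rewrite -(fineK wf) -EFinD -!EFinM -EFinD lee_fin.
rewrite mulrDr lerD2l mulrCA ler_piMr// ?(ltW e0)//.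
by rewrite ler_pdivrMr ?ltr_wpDl// mul1r lerDl.
Qed.

Lemma interp_pred0 : interp_pred 0.
Proof.
have r0 : rep0 (fun=> 0) 0.
  by exists (fun=> 0); split=> [|k]; rewrite linear0//; apply/funext => k;
    rewrite scaler0.
have r1 : rep1 (fun=> 0) 0.
  by exists (fun=> 0); split=> [|k]; rewrite linear0//; apply/funext => k;
    rewrite scaler0.
exact: le_lt_trans (interp_norm_le has_sum0 r0 r1) (ltry _).
Qed.

Lemma interp_pred_closed : submod_closed interp_pred.
Proof.
split=> [|a u v uI vI]; first exact: interp_pred0.
rewrite unfold_in /interp_pred; apply: (le_lt_trans (interp_norm_D _ _)).
apply: lte_add_pinfty => //.
apply: (le_lt_trans (interp_norm_Z_le a uI)).
have uf : interp_norm z u \is a fin_num by rewrite ge0_fin_numE// interp_norm_ge0.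
by rewrite -(fineK uf) -EFinM ltry.
Qed.

(* Each half of the bilateral series is dominated by a geometric one. *)
Lemma half_series_bound (y : nat -> sumsp XX) (v : sumsp XX) (N r : R) :
  0 <= N -> 0 < r -> r < 1 -> (forall n, rnorm (y n) <= N * r ^+ n) ->
  (\sum_(0 <= j < n) y j) @[n --> \oo] --> v -> rnorm v <= N / (1 - r).
Proof.
move=> N0 r0 r1 yN yv; apply/ler_addgt0Pr => e e0.
have e0C : 0 < e%:C by rewrite ltcR.
move/cvgrPdist_lt : yv => /(_ _ e0C)[n _ /(_ n (leqnn n))] /=.
set s := \sum_(0 <= j < n) y j => sv.
have vs : rnorm (v - s) < e by rewrite -ltcR rnormE.
rewrite -(subrK s v) (le_trans (rnormD _ _))// addrC lerD ?(ltW vs)//.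
apply: le_trans (geometric_le_lim n N0 r0 _); last by rewrite gtr0_norm.
rewrite /s /series/=; elim/big_ind2 : _ => [|a b c d ab cd|j _].
- by rewrite rnorm0.
- by rewrite (le_trans (rnormD _ _))// lerD.
- exact: yN.
Qed.

Lemma interp_norm_eq0 w : in_strip z -> interp_norm z w = 0%E -> w = 0.
Proof.
move=> /andP[z0 z1] wz.
pose p := expR (- complex.Re z); pose q := expR (complex.Re z - 1).
have p0 : 0 < p by exact: expR_gt0.
have q0 : 0 < q by exact: expR_gt0.
have p1 : p < 1 by rewrite expR_lt1 oppr_lt0.
have q1 : q < 1 by rewrite expR_lt1 subr_lt0.
have np : rnorm (cexp (- z)) = p by rewrite rnorm_cexp /p; case: (z).
have nq : rnorm (cexp (1 - z)) = q^-1.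
  by rewrite rnorm_cexp -expRN /q opprB; case: (z).
have nX (a : R[i]) n : rnorm (a ^+ n) = rnorm a ^+ n.
  apply: complexI; rewrite rmorphXn/= (rnormE (a : R[i]^o)).
  by rewrite (rnormE (a ^+ n : R[i]^o)) normrX.
have nV (a : R[i]) : rnorm a^-1 = (rnorm a)^-1.
  apply: complexI; rewrite fmorphV/= (rnormE (a : R[i]^o)).
  by rewrite (rnormE (a^-1 : R[i]^o)) normfV.
pose K := (1 - q)^-1 + (1 - p)^-1.
have K0 : 0 < K by rewrite addr_gt0// invr_gt0 subr_gt0.
apply: rnorm_eq0; apply/eqP; rewrite eq_le rnorm_ge0 andbT.
apply/ler_addgt0Pr => e e0; rewrite add0r.
have [x [u0 [u1 [[v1 [v2 [c1 c2 ->]]] x0 x1 lt]]]] :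
    exists x u0 u1, [/\ has_sum x w, rep0 x u0, rep1 x u1 &
      ((l2 (rnorm u0) (rnorm u1))%:E < (e / K)%:E)%E].
  by apply: interp_norm_lt; rewrite wz lte_fin divr_gt0.
rewrite lte_fin in lt; set N := e / K in lt.
have N0 : 0 <= N by rewrite divr_ge0 ?ltW.
have u0N : rnorm u0 <= N := le_trans (le_l2_l _ _) (ltW lt).
have u1N : rnorm u1 <= N := le_trans (le_l2_r _ _) (ltW lt).
have b1 : rnorm v1 <= N / (1 - q).
  apply: half_series_bound c1 => // n.
  have := wrep_bound (@rnorm_in1 R XX) n%:Z x1.
  rewrite -exprnP nX nq exprVn mulrC ler_pdivrMr ?exprn_gt0// => h.
  by rewrite (le_trans h)// ler_wpM2r// exprn_ge0 ?ltW.
have b2 : rnorm v2 <= N / (1 - p).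
  apply: half_series_bound c2 => // n.
  have := wrep_bound (@rnorm_in0 R XX) (- n.+1%:Z) x0.
  rewrite -exprz_inv -exprnP nX nV np exprVn mulrC ler_pdivrMr ?exprn_gt0// => h.
  rewrite (le_trans h)//; apply: (@le_trans _ _ (N * p ^+ n.+1)).
    by rewrite ler_wpM2r// exprn_ge0 ?ltW.
  by rewrite ler_wpM2l// exprS ler_piMl ?exprn_ge0 ?ltW.
rewrite (le_trans (rnormD _ _))// (le_trans (lerD b1 b2))//.
by rewrite -mulrDr /N -/K divfK ?gt_eqF.
Qed.

End InterpTheory.

Section InterpSpace.
Variable z : strip R.

Record interp_sp := InterpSp {
  interp_val : sumsp XX;
  interp_valP : interp_val \in interp_pred z }.

HB.instance Definition _ := [isSub for interp_val].
HB.instance Definition _ := [Choice of interp_sp by <:].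
HB.instance Definition _ :=
  GRing.isSubmodClosed.Build _ _ (interp_pred z) (interp_pred_closed z).
HB.instance Definition _ := [SubChoice_isSubLmodule of interp_sp by <:].

Definition interp_sp_norm (w : interp_sp) : R :=
  fine (interp_norm z (interp_val w)).

Lemma interp_sp_normE w :
  (interp_sp_norm w)%:E = interp_norm z (interp_val w).
Proof.
rewrite /interp_sp_norm fineK// ge0_fin_numE ?interp_norm_ge0//.
exact: (interp_valP w).
Qed.

Lemma interp_sp_norm_D (v w : interp_sp) :
  (interp_sp_norm (v + w))%:C <= (interp_sp_norm v)%:C + (interp_sp_norm w)%:C.
Proof.
rewrite -rmorphD/= lecR -lee_fin EFinD !interp_sp_normE.
exact: interp_norm_D.
Qed.

Lemma interp_sp_norm_Z_le (a : R[i]) (w : interp_sp) :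
  interp_sp_norm (a *: w) <= rnorm a * interp_sp_norm w.
Proof.
rewrite -lee_fin EFinM !interp_sp_normE.
apply: interp_norm_Z_le; exact: (interp_valP w).
Qed.

Lemma interp_sp_norm_Z (a : R[i]) (w : interp_sp) :
  (interp_sp_norm (a *: w))%:C = `|a| * (interp_sp_norm w)%:C.
Proof.
rewrite -(rnormE (a : R[i]^o)) -rmorphM/=; congr (_ %:C).
apply/eqP; rewrite eq_le interp_sp_norm_Z_le/=.
have [->|a0] := eqVneq a 0.
  by rewrite (rnorm0 R[i]^o) mul0r -lee_fin interp_sp_normE interp_norm_ge0.
have := interp_sp_norm_Z_le a^-1 (a *: w).
rewrite scalerA mulVf// scale1r => le.
apply: (le_trans (ler_wpM2l (rnorm_ge0 (a : R[i]^o)) le)).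
rewrite mulrA -(rnormZ a (a^-1 : R[i]^o)) /GRing.scale/= mulfV//.
by rewrite /rnorm normr1/= mul1r.
Qed.

Lemma interp_sp_norm_eq0 (w : interp_sp) : (interp_sp_norm w)%:C = 0 -> w = 0.
Proof.
move=> /complexI w0; apply: val_inj => /=.
apply: (@interp_norm_eq0 z); first exact: stripP.
by rewrite -interp_sp_normE w0.
Qed.

HB.instance Definition _ := Lmodule_isNormed.Build R[i] interp_sp
  interp_sp_norm_D interp_sp_norm_Z interp_sp_norm_eq0.

End InterpSpace.

End Interpolation.

(* Riemann integral over [a, b] of a function with values in a normed space. *)
Definition is_Rint (R : realType) (W : normedModType R[i]) (a b : R)
    (h : R -> W) (I : W) : Prop :=
  forall e : R, 0 < e -> exists2 d : R, 0 < d &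
    forall (n : nat) (p tag : nat -> R),
      p 0%N = a -> p n = b ->
      (forall j, (j < n)%N ->
        p j <= tag j <= p j.+1 /\ p j.+1 - p j < d) ->
      rnorm (\sum_(0 <= j < n) (p j.+1 - p j)%:C *: h (tag j) - I) < e.

Definition Rint (R : realType) (W : normedModType R[i]) (a b : R)
    (h : R -> W) : W :=
  xget 0 [set I | is_Rint a b h I].

Section Hardy.
Variables (R : realType) (XX : seq_couple R).

Definition fourier (f : R[i] -> sumsp XX) (z0 : R[i]) (k : int) : sumsp XX :=
  ((2 * pi)^-1)%:C *:
    Rint 0 (2 * pi)
      (fun t : R => cexp (0 +i* (- (k%:~R * t))) *: f (z0 + (0 +i* t))).

Definition hardy_norm (z0 : R[i]) (f : R[i] -> sumsp XX) : \bar R :=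
  couple_norm z0 (fourier f z0).

(* Elements of the Hardy space are functions on the strip; here they are total
   functions of which only the values on the strip are ever used. The norm is
   computed on the line through [z0]. *)
Definition hardy (z0 : R[i]) (f : R[i] -> sumsp XX) : Prop :=
  [/\ forall z, in_strip z -> derivable (f : R[i]^o -> sumsp XX) z 1,
      forall z, in_strip z -> f (z + (0 +i* (2 * pi))) = f z &
      (hardy_norm z0 f < +oo)%E].

(* [C] bounds division by [cexp - cexp s] on the kernel of evaluation at [s].
   The quotient is undefined at the points s + 2 pi i Z, where its singularities
   are removable: [g] is its (unique) analytic extension to the strip. *)
Definition division_constant (z0 s : R[i]) (C : R) : Prop :=
  0 < C /\
  forall f, hardy z0 f -> f s = 0 ->
    exists g, [/\ hardy z0 g,
      forall z, in_strip z -> cexp z != cexp s ->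
        g z = (cexp z - cexp s)^-1 *: f z &
      (hardy_norm z0 g <= C%:E * hardy_norm z0 f)%E].

End Hardy.

Definition unit_ball (R : realType) (V : normedModType R[i]) : set V :=
  [set x | rnorm x <= 1].

Definition hausdorff_dist (R : realType) (Z : normedModType R[i])
    (A B : set Z) : \bar R :=
  Order.max
    (ereal_sup [set ereal_inf [set (rnorm (a - b))%:E | b in B] | a in A])
    (ereal_sup [set ereal_inf [set (rnorm (a - b))%:E | a in A] | b in B]).

Definition kadets_dist (R : realType) (X Y : normedModType R[i]) : \bar R :=
  ereal_inf [set r | exists (Z : completeNormedModType R[i])
                            (i : {linear X -> Z}) (j : {linear Y -> Z}),
    [/\ forall x, `|i x| = `|x|, forall y, `|j y| = `|y| &
        r = hausdorff_dist (i @` @unit_ball R X) (j @` @unit_ball R Y)]].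

(* Main.v *)
From HB Require Import structures.
Require Import Defs.
From mathcomp Require Import all_boot all_order all_algebra.
From mathcomp Require Import complex.
From mathcomp Require Import all_classical all_reals all_analysis.
From mathcomp Require Import ring lra.

Set Implicit Arguments.
Unset Strict Implicit.
Unset Printing Implicit Defensive.

Import Order.TTheory GRing.Theory Num.Theory.
Import numFieldNormedType.Exports.

Local Open Scope classical_set_scope.
Local Open Scope ring_scope.
Local Open Scope complex_scope.

(** All the interpolation spaces X_z are quotients of one Banach space H. Its
    elements are the sequences a in X_0 + X_1 for which (a_k) lies in S_0 and
    (e^k a_k) lies in S_1 ([laurent_rep]): they are the Laurent coefficients of
    the Hardy functions f(z) = sum_k a_k e^(kz), and their norm does not mention
    the line on which a Hardy norm is computed. Evaluation at z maps H onto X_z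
    and induces its norm, because the substitution x_k = e^(kz) a_k turns the
    infimum defining X_z into an infimum over H ([laurent_interp_norm_le],
    [laurent_interp_norm_lt]).

    Hence the norms at s and t can be compared on H ([interp_norm_gap]). Let f
    have norm at most r, and let f' be a near-optimal representative of f(s). Then
    f - f' vanishes at s and has norm at most about 2 r, so that
    f - f' = (e^z - e^s) g with the norm of g at most 2 C_s r. At z = t this says
    that f' + (e^t - e^s) g represents f(t), whence
    |f(t)|_t <= |f(s)|_s + 2 |e^t - e^s| C_s r, and symmetrically.

    Two quotients of H with such a gap d can be glued: on the sum of X_t and X_s,
    the norm inf (|x - f(t)| + |y + f(s)| + d |f|), over f in H, restricts to the
    two given norms, and makes f(t) and f(s) as close as d |f|. It is equivalent to
    the sum norm since d > 0, so the glued space is complete once the X_z are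
    ([interp_series_cvg]). Therefore the Kadets distance is at most d for every
    d > 0 above 2 |e^t - e^s| max(C_s, C_t) ([kadets_dist_joint_quotient]).

    The division hypothesis speaks of analytic functions, the argument above of
    coefficients. The bridge is that a Laurent series vanishing at m is l - m times
    another Laurent series, with explicit coefficients ([laurent_division]). This
    identifies the analytic quotient, including at its removable singularities.
    Applied to divided differences it also yields the continuity and the
    differentiability of Laurent series; and integrating the series term by term
    ([is_Rint_trigonometric_series]) identifies the Fourier coefficients, so no
    existence theorem for vector-valued integrals is involved. *)

(** * Modulus and exponential of complex numbers *)

Section Modulus.
Variable R : realType.
Implicit Types a b : R[i].

Notation cabs a := (rnorm (a : R[i])).

Lemma cabsE a : (cabs a)%:C = `|a|. Proof. exact: (rnormE (a : R[i]^o)). Qed.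

Lemma cabs_ge0 a : 0 <= cabs a. Proof. exact: (rnorm_ge0 (a : R[i]^o)). Qed.

Lemma cabs_gt0 a : (0 < cabs a) = (a != 0).
Proof. by rewrite -ltcR cabsE normr_gt0. Qed.

Lemma cabsM a b : cabs (a * b) = cabs a * cabs b.
Proof. exact: (rnormZ a (b : R[i]^o)). Qed.

Lemma cabsV a : cabs a^-1 = (cabs a)^-1.
Proof. by apply: complexI; rewrite fmorphV/= !cabsE normfV. Qed.

Lemma cabsX a n : cabs (a ^+ n) = cabs a ^+ n.
Proof. by apply: complexI; rewrite rmorphXn/= !cabsE normrX. Qed.

Lemma cabs_exprz a (k : int) : cabs (a ^ k) = cabs a ^ k.
Proof. by case: k => n; rewrite ?NegzE -?exprz_inv -!exprnP !cabsX ?cabsV. Qed.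

Lemma cabsD a b : cabs (a + b) <= cabs a + cabs b.
Proof. exact: (rnormD (a : R[i]^o) b). Qed.

Lemma cabsB a b : cabs (a - b) = cabs (b - a).
Proof. by rewrite /rnorm distrC. Qed.

Lemma cabs_real (r : R) : cabs r%:C = `|r|.
Proof. by rewrite /rnorm normc_def/= expr0n/= addr0 sqrtr_sqr. Qed.

Lemma cabs_le_ReIm (x y : R) : cabs (x +i* y) <= `|x| + `|y|.
Proof.
rewrite [x +i* y]complexE/=; apply: le_trans (cabsD _ _) _.
rewrite cabsM !cabs_real lerD2l.
by rewrite /rnorm normc_def/= expr0n/= add0r expr1n sqrtr1 mul1r.
Qed.

Lemma Re_le_cabs a : `|complex.Re a| <= cabs a.
Proof.
rewrite /rnorm normc_def/= -sqrtr_sqr ler_wsqrtr// lerDl sqr_ge0//.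
Qed.

Lemma Im_le_cabs a : `|complex.Im a| <= cabs a.
Proof.
rewrite /rnorm normc_def/= -sqrtr_sqr ler_wsqrtr// lerDr sqr_ge0//.
Qed.

Lemma cexpD a b : cexp (a + b) = cexp a * cexp b.
Proof.
case: a b => [x y] [x' y']; rewrite /cexp/= expRD cosD sinD.
by apply/eqP; rewrite eq_complex/=; apply/andP; split; apply/eqP; ring.
Qed.

Lemma cexp0 : cexp 0 = 1 :> R[i].
Proof. by rewrite /cexp/= expR0 cos0 sin0 mul1r. Qed.

Lemma cexp1 : cexp 1 = (expR 1)%:C :> R[i].
Proof. by rewrite /cexp/= cos0 sin0 mulr1. Qed.

Lemma cexp_neq0 a : cexp a != 0.
Proof. by rewrite -cabs_gt0 rnorm_cexp expR_gt0. Qed.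

Lemma cexpN a : cexp (- a) = (cexp a)^-1.
Proof.
apply: (mulfI (cexp_neq0 a)); rewrite -cexpD subrr cexp0 mulfV//.
exact: cexp_neq0.
Qed.

Lemma cexpMz a (k : int) : cexp (a * k%:~R) = cexp a ^ k.
Proof.
have nat_case (n : nat) : cexp (a * n%:R) = cexp a ^+ n.
  elim: n => [|n IH]; first by rewrite mulr0 cexp0 expr0.
  by rewrite -natr1 mulrDr mulr1 cexpD IH exprSr.
case: k => n; first by rewrite -exprnP -nat_case.
by rewrite NegzE mulrNz mulrN cexpN -exprz_inv -exprnP exprVn -nat_case.
Qed.

Lemma cexp_period a : cexp (a + (0 +i* (2 * pi))) = cexp a.
Proof.
by rewrite cexpD /cexp/= expR0 mulr_natl cos2pi sin2pi mul1r mulr1.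
Qed.

Lemma cexp_annulus a : in_strip a -> 1 < rnorm (cexp a) < expR 1.
Proof.
by move=> /andP[a0 a1]; rewrite rnorm_cexp -{1}expR0 !ltr_expR a0.
Qed.

End Modulus.
Local Notation cabs a := (rnorm (a : _[i])).

Section CvgRnorm.
Variables (R : realType) (V : normedModType R[i]).

Lemma cvg_rnormP (T : Type) (F : set_system T) {FF : Filter F} (f : T -> V) l :
  f @ F --> l <-> forall e : R, 0 < e -> \forall x \near F, rnorm (l - f x) < e.
Proof.
split=> [/cvgrPdist_lt fl e e0|fl].
  have e0C : 0 < e%:C by rewrite ltcR.
  by have := fl _ e0C; apply: filterS => x; rewrite -rnormE ltcR.
apply/cvgrPdist_lt => e e0.
have [r Er] : exists r : R, e = r%:C.
  by apply/complex_realP; rewrite gtr0_real.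
rewrite Er in e0 *; rewrite ltcR in e0.
by apply: filterS (fl _ e0) => x xr; rewrite -rnormE ltcR.
Qed.

Lemma rnormB (x y : V) : rnorm (x - y) = rnorm (y - x).
Proof. by rewrite /rnorm distrC. Qed.

End CvgRnorm.

Section CexpDerivative.
Variable R : realType.

Lemma is_derive0_estimate (f : R -> R) (f' e : R) : is_derive (0 : R) 1 f f' ->
  0 < e -> \forall x \near (0 : R), `|f x - f 0 - f' * x| <= e * `|x|.
Proof.
move=> [fd <-] e0.
have /cvgrPdist_le/(_ e e0) := fd; rewrite near_withinE.
apply: filterS => x H.
have [->|x0] := eqVneq x 0; first by rewrite mulr0 subr0 subrr normr0 mulr0.
have {H} := H x0; rewrite /= addr0 [x%:A]mulr1 => H.
have -> : f x - f 0 - 'D_1 f 0 * x = - (('D_1 f 0 - x^-1 *: (f x - f 0)) * x).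
  by rewrite /GRing.scale/=; field.
by rewrite normrN normrM ler_wpM2r.
Qed.

Lemma cexp_estimate (e : R) : 0 < e -> exists2 d : R, 0 < d &
  forall h : R[i], cabs h < d -> cabs (cexp h - 1 - h) <= e * cabs h.
Proof.
move=> e0; have e6 : 0 < e / 6 by rewrite divr_gt0.
have Hexp := is_derive0_estimate (is_derive_expR 0) e6.
have Hexp1 := is_derive0_estimate (is_derive_expR 0) ltr01.
have Hcos := is_derive0_estimate (is_derive_cos 0) e6.
have Hsin := is_derive0_estimate (is_derive_sin 0) e6.
have [d /= d0 dP] := filterI Hexp (filterI Hexp1 (filterI Hcos Hsin)).
(* The bound 1 / 2 keeps the real exponential below 2; with e / 12 the product
   of the two first-order terms costs one more of the six shares of e. *)
pose d' := Num.min d (Num.min (1 / 2) (e / 12)).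
exists d'; first by rewrite !lt_min d0 divr_gt0// divr_gt0.
move=> h hd; have [x [y Eh]] : exists x y : R, h = x +i* y.
  by case: (h) => x y; exists x, y.
have xh : `|x| <= cabs h by have := Re_le_cabs h; rewrite {1}Eh.
have yh : `|y| <= cabs h by have := Im_le_cabs h; rewrite {1}Eh.
move: hd; rewrite !lt_min => /and3P[hd h1 he].
have near0 (r : R) : `|r| <= cabs h -> ball (0 : R) d r.
  by move=> rh; rewrite /ball/= sub0r normrN (le_lt_trans rh).
have [ex [ex1 [_ _]]] := dP _ (near0 _ xh).
have [_ [_ [cy sy]]] := dP _ (near0 _ yh).
rewrite expR0 !mul1r in ex ex1; rewrite cos0 sin0 oppr0 mul0r subr0 in cy.
rewrite sin0 cos0 mul1r subr0 in sy.
have -> : cexp h - 1 - h = (expR x * (cos y - 1) + (expR x - 1 - x))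
                        +i* (expR x * (sin y - y) + (expR x - 1) * y).
  by rewrite Eh; apply/eqP; rewrite eq_complex/=; apply/andP; split; apply/eqP; ring.
apply: (le_trans (cabs_le_ReIm _ _)).
have E2 : expR x <= 2.
  by have := ler_norm (expR x - 1 - x); have := ler_norm x; lra.
have E1 : `|expR x - 1| <= 2 * cabs h.
  rewrite -(subrK x (expR x - 1)) (le_trans (ler_normD _ _))//.
  by rewrite mulr2n mulrDl mul1r lerD// (le_trans ex1).
have E3 : `|expR x - 1| * `|y| <= e / 6 * cabs h.
  have -> : e / 6 * cabs h = (2 * (e / 12)) * cabs h by field.
  rewrite ler_pM// (le_trans E1)// ler_wpM2l// ltW//.
have E4 : `|expR x * (cos y - 1)| <= 2 * (e / 6 * cabs h).
  rewrite normrM ger0_norm ?expR_ge0// ler_pM ?expR_ge0//.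
  by rewrite (le_trans cy)// ler_wpM2l// ltW.
have E5 : `|expR x * (sin y - y)| <= 2 * (e / 6 * cabs h).
  rewrite normrM ger0_norm ?expR_ge0// ler_pM ?expR_ge0//.
  by rewrite (le_trans sy)// ler_wpM2l// ltW.
have E6 : `|expR x - 1 - x| <= e / 6 * cabs h.
  by rewrite (le_trans ex)// ler_wpM2l// ltW.
have -> : e * cabs h = (2 * (e / 6 * cabs h) + e / 6 * cabs h) +
                       (2 * (e / 6 * cabs h) + e / 6 * cabs h) by field.
rewrite lerD// (le_trans (ler_normD _ _))// lerD//.
by rewrite normrM.
Qed.
End CexpDerivative.

(* Keeps unification from comparing exponentials through their real and
   imaginary parts. *)
#[global] Opaque cexp.

(** * Geometric and bilateral series *)

Section Series.
Variable R : realType.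

Lemma rnorm_sum (V : normedModType R[i]) (I : Type) (s : seq I) (P : pred I)
    (y : I -> V) :
  rnorm (\sum_(i <- s | P i) y i) <= \sum_(i <- s | P i) rnorm (y i).
Proof.
elim/big_ind2 : _ => [|a b c d ab cd|j _//]; first by rewrite rnorm0.
by rewrite (le_trans (rnormD _ _))// lerD.
Qed.

Lemma geometric_tail_le (M r : R) m n : 0 <= M -> 0 < r -> r < 1 ->
  \sum_(m <= j < n) M * r ^+ j <= M * r ^+ m / (1 - r).
Proof.
move=> M0 r0 r1; have r0' := ltW r0.
have [nm|mn] := leqP n m.
  by rewrite big_geq// divr_ge0 ?subr_ge0 ?(ltW r1)// mulr_ge0 ?exprn_ge0.
rewrite -{1}(add0n m) big_addn.
under eq_bigr do rewrite exprD mulrCA mulrC.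
apply: (geometric_le_lim (n - m) _ r0); last by rewrite gtr0_norm.
by rewrite mulr_ge0 ?exprn_ge0.
Qed.

Lemma geometric_series_cvg (V : completeNormedModType R[i]) (y : nat -> V)
    (M r : R) : 0 <= M -> 0 < r -> r < 1 ->
  (forall n, rnorm (y n) <= M * r ^+ n) -> exists v : V, series y @ \oo --> v.
Proof.
move=> M0 r0 r1 yM; apply/cvg_ex.
apply/cauchy_cvgP/cauchy_seriesP => e e0.
have [e' Ee] : exists e' : R, e = e'%:C.
  by apply/complex_realP; rewrite gtr0_real.
rewrite Ee in e0 *; rewrite ltcR in e0.
have r1' : `|r| < 1 by rewrite gtr0_norm.
have /cvgrPdist_lt/(_ e' e0) := cvg_geometric (M / (1 - r)) r1'.
move=> [N _ NP]; exists ([set n | (N <= n)%N], setT) => /=.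
  by split; [exists N | exact: filterT].
move=> [m n] [/= Nm _]; rewrite -rnormE ltcR.
apply: (le_lt_trans (rnorm_sum _ _ _)).
apply: (@le_lt_trans _ _ (\sum_(m <= j < n) M * r ^+ j)).
  by apply: ler_sum => j _; exact: yM.
apply: (le_lt_trans (geometric_tail_le _ _ M0 r0 r1)).
have := NP m Nm; rewrite /= sub0r normrN; apply: le_lt_trans.
by apply: (le_trans _ (ler_norm _)); rewrite mulrAC.
Qed.

Lemma series_tail_le (V : normedModType R[i]) (y : nat -> V) (v : V)
    (M r : R) m : 0 <= M -> 0 < r -> r < 1 ->
  (forall n, rnorm (y n) <= M * r ^+ n) -> series y @ \oo --> v ->
  rnorm (v - series y m) <= M * r ^+ m / (1 - r).
Proof.
move=> M0 r0 r1 yM /cvg_rnormP yv; apply/ler_addgt0Pr => e e0.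
have [N _ NP] := yv e e0.
have := NP (maxn N m) (leq_maxl _ _) => /= ve.
rewrite -(subrK (series y (maxn N m)) v) -addrA.
rewrite (le_trans (rnormD _ _))// [leRHS]addrC lerD ?(ltW ve)//.
rewrite sub_series leq_maxr (le_trans (rnorm_sum _ _ _))//.
apply: (le_trans _ (geometric_tail_le _ (maxn N m) M0 r0 r1)).
by apply: ler_sum => j _; exact: yM.
Qed.

Lemma series_le (V : normedModType R[i]) (y : nat -> V) (v : V) (M r : R) :
  0 <= M -> 0 < r -> r < 1 ->
  (forall n, rnorm (y n) <= M * r ^+ n) -> series y @ \oo --> v ->
  rnorm v <= M / (1 - r).
Proof.
move=> M0 r0 r1 yM yv; have := series_tail_le 0 M0 r0 r1 yM yv.
by rewrite /series/= big_geq// subr0 expr0 mulr1.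
Qed.

Lemma cvg_seriesS (V : normedModType R[i]) (y : nat -> V) (v : V) :
  series y @ \oo --> v <-> series (fun n => y n.+1) @ \oo --> v - y 0%N.
Proof.
have E : (fun n => series y n.+1) = (fun n => y 0%N + series (fun n => y n.+1) n).
  by apply/funext => n; rewrite /series/= big_nat_recl.
rewrite -(cvg_shiftS (series y)) /= [X in X @ \oo --> _ <-> _]E; split=> H.
  rewrite (_ : series (fun n => y n.+1) =
    (fun n => (y 0%N + series (fun n => y n.+1) n) - y 0%N)).
    by apply: cvgB H _; exact: cvg_cst.
  by apply/funext => n; rewrite addrC addrA addNr add0r.
by rewrite -(subrK (y 0%N) v) addrC; apply: cvgD H; exact: cvg_cst.
Qed.

(** Completeness only needs to be tested on series dominated by a fixed
    geometric one: a Cauchy filter contains balls of radius 2^-n, whose centres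
    are the partial sums of such a series. *)
Lemma complete_of_series (V : normedModType R[i]) :
  (forall y : nat -> V, (forall n, rnorm (y n) <= 2^-1 ^+ n) ->
     exists v : V, series y @ \oo --> v) ->
  forall F : set_system V, ProperFilter F -> cauchy F -> cvg F.
Proof.
move=> H F FF /cauchyP cF.
have Hx n : exists x : V, F [set y | rnorm (x - y) < 2^-1 ^+ n.+2].
  have e0 : 0 < ((2^-1 : R) ^+ n.+2)%:C by rewrite ltcR exprn_gt0.
  have [x Fx] := cF _ e0; exists x; apply: filterS Fx => y.
  by rewrite -ball_normE /ball_/= -rnormE ltcR.
have {Hx}[x xP] := choice Hx.
have dx n : rnorm (x n.+1 - x n) <= 2^-1 ^+ n.
  have [y [/= y1 y2]] := filter_ex (filterI (xP n.+1) (xP n)).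
  have -> : x n.+1 - x n = (x n.+1 - y) - (x n - y).
    by rewrite opprB addrA subrK.
  rewrite (le_trans (rnormD _ _))// rnormN (le_trans (lerD (ltW y1) (ltW y2)))//.
  have : 0 < (2^-1 : R) ^+ n by rewrite exprn_gt0.
  by rewrite !exprS; move: (2^-1 ^+ n) => q q0; lra.
have [v vP] := H _ dx.
have xv : x @ \oo --> v + x 0%N.
  rewrite [in x @ _](_ : x = (fun n => series (fun n => x n.+1 - x n) n + x 0%N)).
    by apply: cvgD; [exact: vP|exact: cvg_cst].
  by apply/funext => n; rewrite /series/= telescope_sumr// subrK.
apply: (cvgP (v + x 0%N)); apply/cvg_rnormP => e e0.
have e2 : 0 < e / 2 by rewrite divr_gt0.
have /cvgrPdist_lt/(_ (e / 2) e2) : geometric 1 (2^-1 : R) @ \oo --> 0.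
  by apply: cvg_geometric; rewrite gtr0_norm// invf_lt1// ltr1n.
have /cvg_rnormP/(_ (e / 2) e2) := xv.
move=> xe qe; have [n [/= xn qn]] := filter_ex (filterI xe qe).
apply: filterS (xP n) => y /= yn.
rewrite -(subrK (x n) (v + x 0%N)) -addrA (le_lt_trans (rnormD _ _))//.
rewrite [e]splitr ltrD// (lt_le_trans yn)//.
move: qn; rewrite sub0r normrN mul1r gtr0_norm ?exprn_gt0// => /ltW.
apply: le_trans; rewrite !exprS.
have : 0 < (2^-1 : R) ^+ n by rewrite exprn_gt0.
by move: (2^-1 ^+ n) => q q0; lra.
Qed.

End Series.

Section HasSum.
Variables (R : realType) (W : normedModType R[i]).
Implicit Types (x y : int -> W) (w : W).

Lemma has_sum_ext x y w : x =1 y -> has_sum x w -> has_sum y w.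
Proof. by move=> /funext ->. Qed.

Lemma has_sum_unique x w w' : has_sum x w -> has_sum x w' -> w = w'.
Proof.
move=> [u [v [xu xv ->]]] [u' [v' [xu' xv' ->]]].
by rewrite (cvg_unique (@norm_hausdorff _ _) xu xu')
           (cvg_unique (@norm_hausdorff _ _) xv xv').
Qed.

Lemma has_sumB x y v w :
  has_sum x v -> has_sum y w -> has_sum (fun k => x k - y k) (v - w).
Proof.
move=> [v1 [v2 [c1 c2 ->]]] [w1 [w2 [d1 d2 ->]]].
exists (v1 - w1), (v2 - w2); split; last by rewrite addrACA opprD.
  by under eq_fun do rewrite sumrB; exact: cvgB.
by under eq_fun do rewrite sumrB; exact: cvgB.
Qed.

Lemma has_sumMl c x v : has_sum x v -> has_sum (fun k => c *: x k) (c *: v).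
Proof.
move=> [v1 [v2 [c1 c2 ->]]].
exists (c *: v1), (c *: v2); split; last by rewrite scalerDr.
  by under eq_fun do rewrite -scaler_sumr; exact: cvgZl_tmp.
by under eq_fun do rewrite -scaler_sumr; exact: cvgZl_tmp.
Qed.

(** A bilateral series cut at an arbitrary index instead of 0. Moving the cut one
    step transfers one term, which gives shift invariance, and the halves at all
    cuts are, up to powers, the coefficients needed for division. *)
Definition half_sums x (k : int) (u v : W) : Prop :=
  series (fun n : nat => x (n%:Z + k)) @ \oo --> u /\
  series (fun n : nat => x (- n.+1%:Z + k)) @ \oo --> v.

Lemma half_sums_succ x k u v :
  half_sums x k u v <-> half_sums x (k + 1) (u - x k) (v + x k).
Proof.
rewrite /half_sums (cvg_seriesS (fun n : nat => x (n%:Z + k))).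
rewrite (cvg_seriesS (fun n : nat => x (- n.+1%:Z + (k + 1)))) add0r.
have -> : - 1%:Z + (k + 1) = k by ring.
rewrite addrK.
have -> : (fun n => x (n.+1%:Z + k)) = (fun n => x (n%:Z + (k + 1))).
  by apply/funext => n; congr x; rewrite intS; ring.
have -> : (fun n => x (- n.+2%:Z + (k + 1))) = (fun n => x (- n.+1%:Z + k)).
  apply/funext => n; congr x. rewrite intS; ring.
by [].
Qed.

Lemma half_sums_all x w : has_sum x w -> forall k, exists u, half_sums x k u (w - u).
Proof.
move=> [u0 [v0 [xu xv ->]]]; elim/int_ind => [|n [u IH]|n [u IH]].
- have E (g : nat -> int) : (fun n => x (g n + 0)) = (fun n => x (g n)).
    by apply/funext => n; rewrite addr0.
  by exists u0; rewrite addrC addKr; split; rewrite E.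
- exists (u - x n); have := (half_sums_succ _ _ _ _).1 IH.
  have -> : n%:Z + 1 = n.+1%:Z by rewrite intS addrC.
  by rewrite opprB [x n - u]addrC addrA.
- exists (u + x (- n.+1%:Z)); apply/half_sums_succ.
  have -> : - n.+1%:Z + 1 = - n%:Z by rewrite intS; ring.
  by rewrite addrK opprD addrA subrK.
Qed.

Lemma has_sum_shift x w k : has_sum x w -> has_sum (fun j => x (j + k)) w.
Proof.
move=> /half_sums_all/(_ k)[u [h1 h2]]; exists u, (w - u); split=> //.
by rewrite addrC subrK.
Qed.

End HasSum.

(** * Laurent series in the sum space *)

Section SumSpaceSeries.
Variables (R : realType) (XX : compatible_couple R).

Lemma cvg_contraction (T : Type) (F : set_system T) {FF : Filter F}
    (V W : normedModType R[i]) (f : {linear V -> W}) (u : T -> V) (l : V) :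
  (forall x, rnorm (f x) <= rnorm x) -> u @ F --> l -> (fun t => f (u t)) @ F --> f l.
Proof.
move=> fle /cvg_rnormP ul; apply/cvg_rnormP => e /ul.
by apply: filterS => t; apply: le_lt_trans; rewrite -linearB fle.
Qed.

(** The sum space inherits this form of completeness from its two summands:
    near-optimal decompositions of the terms are geometrically small too. *)
Lemma sumsp_series_cvg (y : nat -> sumsp XX) (M r : R) : 0 <= M -> 0 < r -> r < 1 ->
  (forall n, rnorm (y n) <= M * r ^+ n) -> exists v : sumsp XX, series y @ \oo --> v.
Proof.
move=> M0 r0 r1 yM.
have H n : exists p : cc_X0 XX * cc_X1 XX,
    y n = in0 p.1 + in1 p.2 /\ rnorm p.1 + rnorm p.2 <= (M + 1) * r ^+ n.
  have rn : 0 < r ^+ n by rewrite exprn_gt0.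
  have [x0 [x1 [E lt]]] := sum_norm_adherent (y n) rn.
  exists (x0, x1); split; first by apply: val_inj.
  by rewrite (le_trans (ltW lt))// mulrDl mul1r lerD2r; exact: yM.
have {H}[p pP] := choice H.
have M1 : 0 <= M + 1 by rewrite addr_ge0.
have p0 n : rnorm (p n).1 <= (M + 1) * r ^+ n.
  by have [_] := pP n; apply: le_trans; rewrite lerDl rnorm_ge0.
have p1 n : rnorm (p n).2 <= (M + 1) * r ^+ n.
  by have [_] := pP n; apply: le_trans; rewrite lerDr rnorm_ge0.
have [v0 c0] := geometric_series_cvg M1 r0 r1 p0.
have [v1 c1] := geometric_series_cvg M1 r0 r1 p1.
exists (in0 v0 + in1 v1).
rewrite (_ : series y = fun n => in0 (series (fun n => (p n).1) n) +
                               in1 (series (fun n => (p n).2) n)).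
  by apply: cvgD; apply: cvg_contraction => //; [exact: rnorm_in0|exact: rnorm_in1].
apply/funext => n; rewrite /series/= !linear_sum -big_split/=.
by apply: eq_bigr => j _; have [->] := pP j.
Qed.

End SumSpaceSeries.

Section Laurent.
Variables (R : realType) (XX : compatible_couple R).
Implicit Types (a b : int -> sumsp XX) (l m : R[i]).

(** The terms of the Laurent series are bounded by [M] on both boundary circles. *)
Definition growth (M : R) a : Prop :=
  forall k, rnorm (a k) <= M /\ rnorm (a k) * expR 1 ^ k <= M.

(** The image of the strip under the exponential. *)
Definition annulus l : Prop := 1 < cabs l < expR 1.

Definition laurent_term a l (k : int) : sumsp XX := l ^ k *: a k.

Definition laurent a l : sumsp XX := xget 0 [set w | has_sum (laurent_term a l) w].

Lemma growth_ge0 M a : growth M a -> 0 <= M.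
Proof. by move=> /(_ 0)[+ _]; apply: le_trans; exact: rnorm_ge0. Qed.

Lemma annulus_gt0 l : annulus l -> 0 < cabs l.
Proof. by move=> /andP[l1 _]; rewrite (lt_trans _ l1). Qed.

Lemma annulus_neq0 l : annulus l -> l != 0.
Proof. by rewrite -cabs_gt0; exact: annulus_gt0. Qed.

Lemma annulus_out l : annulus l -> 0 < cabs l / expR 1 < 1.
Proof.
move=> al; have l0 := annulus_gt0 al; move: al => /andP[l1 le].
by rewrite divr_gt0 ?expR_gt0//= ltr_pdivrMr ?expR_gt0// mul1r.
Qed.

Lemma annulus_in l : annulus l -> 0 < (cabs l)^-1 < 1.
Proof.
move=> al; have l0 := annulus_gt0 al; move: al => /andP[l1 le].
by rewrite invr_gt0 l0 invf_lt1.
Qed.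

Lemma laurent_term_out M a l (k : int) (n : nat) : growth M a -> annulus l ->
  rnorm (laurent_term a l (n%:Z + k)) <=
    M * (cabs l / expR 1) ^ k * (cabs l / expR 1) ^+ n.
Proof.
move=> aM al; have l0 := annulus_gt0 al; have e0 : 0 < expR 1 :> R := expR_gt0 1.
have q0 : cabs l / expR 1 != 0 by rewrite gt_eqF// divr_gt0.
have -> : M * (cabs l / expR 1) ^ k * (cabs l / expR 1) ^+ n =
    M * (cabs l ^ (n%:Z + k) * (expR 1 ^ (n%:Z + k))^-1).
  rewrite exprnP -mulrA -expfzDr// [k + _]addrC expfzMl; congr (_ * (_ * _)).
  by rewrite invr_expz exprz_inv.
have [_ aj] := aM (n%:Z + k).
rewrite /laurent_term rnormZ cabs_exprz mulrCA ler_wpM2l ?exprz_ge0 ?(ltW l0)//.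
by rewrite ler_pdivlMr ?exprz_gt0.
Qed.

Lemma laurent_term_in M a l (k : int) (n : nat) : growth M a -> annulus l ->
  rnorm (laurent_term a l (- n.+1%:Z + k)) <=
    M * (cabs l) ^ (k - 1) * (cabs l)^-1 ^+ n.
Proof.
move=> aM al; have l0 := annulus_gt0 al.
rewrite /laurent_term rnormZ cabs_exprz exprnP exprz_inv -mulrA -expfzDr ?gt_eqF//.
have -> : k - 1 - n%:Z = - n.+1%:Z + k by rewrite intS; ring.
have [aj _] := aM (- n.+1%:Z + k).
by rewrite mulrC ler_wpM2r// exprz_ge0// ltW.
Qed.

Lemma laurent_exists M a l : growth M a -> annulus l ->
  exists w, has_sum (laurent_term a l) w.
Proof.
move=> aM al; have M0 := growth_ge0 aM; have l0 := annulus_gt0 al.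
have /andP[q0 q1] := annulus_out al; have /andP[p0 p1] := annulus_in al.
have [|u uP] := @sumsp_series_cvg _ XX
    (fun n : nat => laurent_term a l (n%:Z + 0)) _ _ _ q0 q1
    (fun n => laurent_term_out 0 n aM al).
  by rewrite mulr_ge0// exprz_ge0// ltW.
have [|v vP] := @sumsp_series_cvg _ XX
    (fun n : nat => laurent_term a l (- n.+1%:Z + 0)) _ _ _ p0 p1
    (fun n => laurent_term_in 0 n aM al).
  by rewrite mulr_ge0// exprz_ge0// ltW.
exists (u + v), u, v; split=> //.
  by move: uP; under eq_fun do rewrite addr0.
by move: vP; under eq_fun do rewrite addr0.
Qed.

Lemma laurentP M a l : growth M a -> annulus l ->
  has_sum (laurent_term a l) (laurent a l).
Proof. by move=> aM /(laurent_exists aM)[w wP]; apply: (@xgetI _ 0 _ w). Qed.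

Lemma laurentE M a l w : growth M a -> annulus l ->
  has_sum (laurent_term a l) w -> laurent a l = w.
Proof. by move=> aM al; apply: has_sum_unique; exact: laurentP aM al. Qed.

Lemma laurent_le M a l : growth M a -> annulus l ->
  rnorm (laurent a l) <= M / (1 - cabs l / expR 1) + M / (1 - (cabs l)^-1).
Proof.
move=> aM al; have M0 := growth_ge0 aM; have l0 := annulus_gt0 al.
have /andP[q0 q1] := annulus_out al; have /andP[p0 p1] := annulus_in al.
have [u [v [uP vP ->]]] := laurentP aM al.
apply: (le_trans (rnormD _ _)); apply: lerD.
  apply: (series_le M0 q0 q1 _ uP) => n.
  by have := laurent_term_out 0 n aM al; rewrite addr0 expr0z mulr1.
apply: (series_le M0 p0 p1 _ vP) => n.
have := laurent_term_in 0 n aM al; rewrite addr0 => /le_trans; apply.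
rewrite ler_wpM2r ?exprn_ge0 ?(ltW p0)//.
by rewrite ler_piMr// add0r -invr_expz (ltW p1).
Qed.

End Laurent.

Section LaurentCalculus.
Variables (R : realType) (XX : compatible_couple R).
Implicit Types (a b : int -> sumsp XX) (l m : R[i]).

Lemma laurent_division_term a b m : (forall k, a k = b (k - 1) - m *: b k) ->
  forall M l, growth M b -> annulus l ->
    has_sum (laurent_term a l) ((l - m) *: laurent b l).
Proof.
move=> ab M l bM al; have l0 := annulus_neq0 al.
have bl := laurentP bM al.
have := has_sumB (has_sumMl l (has_sum_shift (-1) bl)) (has_sumMl m bl).
rewrite -scalerBl; congr (has_sum _ _); apply/funext => k.
rewrite /laurent_term ab scalerBr !scalerA; congr (_ *: _ - _ *: _); last exact: mulrC.
by rewrite -{1}(expr1z l) -expfzDr// addrC subrK.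
Qed.

(** The coefficients of the quotient are, up to powers of [m], tails of the
    vanishing series; since the tail towards +oo is minus the tail towards -oo,
    they are controlled in both directions. *)
Lemma laurent_division M a m : growth M a -> annulus m -> laurent a m = 0 ->
  exists M' b, [/\ growth M' b, forall k, a k = b (k - 1) - m *: b k &
    forall l, annulus l -> laurent a l = (l - m) *: laurent b l].
Proof.
move=> aM am a0; have M0 := growth_ge0 aM; have m0 := annulus_gt0 am.
have mn0 := annulus_neq0 am.
have /andP[q0 q1] := annulus_out am; have /andP[p0 p1] := annulus_in am.
have := laurentP aM am; rewrite a0 => /half_sums_all tails.
have /choice[T TP] : forall k, exists u, half_sums (laurent_term a m) (k + 1) u (- u).
  by move=> k; have [u] := tails (k + 1); rewrite sub0r => uP; exists u.
(* From b (k - 1) - m b k = a k, the sequence m ^ (k + 1) b k has the differences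
   of the tails of the series at m. *)
pose b k := m ^ (- (k + 1)) *: T k.
have ab k : a k = b (k - 1) - m *: b k.
  have [+ _] := (half_sums_succ _ _ _ _).1 (TP (k - 1)).
  have [+ _] := TP k; rewrite subrK => h1 h2.
  have Tk : T k = T (k - 1) - laurent_term a m k.
    exact: (cvg_unique (@norm_hausdorff _ _) h1 h2).
  rewrite /b Tk subrK scalerA -{2}(expr1z m) -expfzDr//.
  have -> : 1 + - (k + 1) = - k by ring.
  rewrite scalerBr opprB addrC subrK /laurent_term scalerA -expfzDr//.
  by rewrite addNr expr0z scale1r.
have e0 : 0 < expR 1 :> R := expR_gt0 1.
have bnorm k : rnorm (b k) = (cabs m ^ (k + 1))^-1 * rnorm (T k).
  by rewrite rnormZ cabs_exprz invr_expz.
pose M1 := M / (1 - cabs m / expR 1); pose M2 := M / (1 - (cabs m)^-1).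
have M10 : 0 <= M1 by rewrite divr_ge0// subr_ge0 ltW.
have M20 : 0 <= M2 by rewrite divr_ge0// subr_ge0 ltW.
have bM : growth (M1 + M2) b.
  move=> k; have [t1 t2] := TP k; split.
    (* On the inner circle [T k] is estimated by the opposite tail [- T k]. *)
    have : rnorm (- T k) <= M * cabs m ^ k / (1 - (cabs m)^-1).
      apply: (series_le _ p0 p1 _ t2) => [|n].
        by rewrite mulr_ge0// exprz_ge0// ltW.
      by have := laurent_term_in (k + 1) n aM am; rewrite addrK.
    rewrite rnormN bnorm mulrAC -/M2 => h.
    rewrite mulrC ler_pdivrMr ?exprz_gt0// (le_trans h)//.
    rewrite ler_pM ?exprz_ge0 ?(ltW m0)// ?lerDr//.
    rewrite exprzDr ?unitfE ?gt_eqF// expr1z ler_peMr ?exprz_ge0 ?(ltW m0)//.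
    by move: am => /andP[/ltW].
  have : rnorm (T k) <= M * (cabs m / expR 1) ^ (k + 1) / (1 - cabs m / expR 1).
    apply: (series_le _ q0 q1 _ t1) => [|n].
      by rewrite mulr_ge0// exprz_ge0// ltW.
    exact: laurent_term_out aM am.
  rewrite bnorm mulrAC -/M1 => h.
  have {}h : (cabs m ^ (k + 1))^-1 * rnorm (T k) <= M1 / expR 1 ^ (k + 1).
    rewrite mulrC ler_pdivrMr ?exprz_gt0// (le_trans h)//.
    by rewrite expfzMl exprz_inv -invr_expz mulrA mulrAC.
  apply: (le_trans (ler_wpM2r _ h)); first by rewrite exprz_ge0// ltW.
  have -> : M1 / expR 1 ^ (k + 1) * expR 1 ^ k = M1 / expR 1.
    rewrite exprzDr ?unitfE ?gt_eqF// expr1z -mulrA; congr (_ * _).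
    by rewrite invfM mulrAC mulVf ?gt_eqF ?exprz_gt0// mul1r.
  rewrite (@le_trans _ _ M1) ?lerDl//.
  by rewrite ler_piMr// invf_le1// -[leLHS]expR0 ler_expR.
exists (M1 + M2), b; split=> // l al.
exact: laurentE aM al (laurent_division_term ab bM al).
Qed.

Lemma has_sum_constant_term l (w : sumsp XX) :
  has_sum (laurent_term (fun k : int => if k == 0 then w else 0) l) w.
Proof.
have cvg0 (y : nat -> sumsp XX) : (forall n, y n = 0) -> series y @ \oo --> (0 : sumsp XX).
  move=> y0; rewrite (_ : series y = fun=> 0); first exact: cvg_cst.
  by apply/funext => n; rewrite /series/= big1.
exists w, 0; split; last by rewrite addr0.
  apply/(cvg_seriesS (fun n : nat => laurent_term _ l n%:Z)).
  rewrite /laurent_term/= expr0z scale1r subrr.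
  by apply: cvg0 => n; rewrite scaler0.
by apply: cvg0 => n; rewrite /laurent_term/= scaler0.
Qed.

(** The divided difference of a Laurent series is again one. This is the only
    analytic input for its continuity and differentiability. *)
Lemma laurent_divided_difference M a m : growth M a -> annulus m ->
  exists M' b, growth M' b /\
    forall l, annulus l -> laurent a l - laurent a m = (l - m) *: laurent b l.
Proof.
move=> aM am; have M0 := growth_ge0 aM; pose w := laurent a m.
pose c k := a k - if k == 0 then w else 0.
have cM : growth (M + rnorm w) c.
  move=> k; have [a1 a2] := aM k; rewrite /c.
  case: eqVneq a1 a2 => [->|_] a1 a2; last first.
    by rewrite subr0; split; rewrite (le_trans a1, le_trans a2) ?lerDl ?rnorm_ge0.
  by rewrite expr0z mulr1; split; rewrite (le_trans (rnormD _ _))// rnormN lerD.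
have cE l : annulus l -> laurent c l = laurent a l - w.
  move=> al; apply: (laurentE cM al).
  have := has_sumB (laurentP aM al) (has_sum_constant_term l w).
  by congr (has_sum _ _); apply/funext => k; rewrite /laurent_term scalerBr.
have [|M' [b [bM _ H]]] := laurent_division cM am; first by rewrite cE// subrr.
by exists M', b; split=> [//|l al]; rewrite -H// cE.
Qed.

(** The bound of [laurent_le] is monotone on either side, hence uniform on the
    closed annulus halfway towards the boundary circles. *)
Lemma laurent_bounded_near M a m : growth M a -> annulus m ->
  exists K d, [/\ 0 < K, 0 < d & forall l, cabs (l - m) < d ->
    annulus l /\ rnorm (laurent a l) <= K].
Proof.
move=> aM am; have M0 := growth_ge0 aM; move: (am) => /andP[m1 me].
have e0 : 0 < expR 1 :> R := expR_gt0 1.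
pose r1 := (1 + cabs m) / 2; pose r2 := (cabs m + expR 1) / 2.
have r11 : 1 < r1 by rewrite /r1; lra.
have r2e : r2 < expR 1 by rewrite /r2; lra.
pose K := M / (1 - r2 / expR 1) + M / (1 - r1^-1).
have q1 : r2 / expR 1 < 1 by rewrite ltr_pdivrMr// mul1r.
have p1 : r1^-1 < 1 by rewrite invf_lt1// (lt_trans _ r11).
have K0 : 0 <= K by rewrite addr_ge0// divr_ge0// subr_ge0 ltW.
exists (K + 1), (Num.min (cabs m - r1) (r2 - cabs m)); split.
- by rewrite ltr_wpDl.
- by rewrite lt_min !subr_gt0 /r1 /r2; apply/andP; split; lra.
move=> l; rewrite lt_min => /andP[lm1 lm2].
have l1 : r1 < cabs l.
  have := cabsD (m - l) l; rewrite subrK cabsB; move: lm1; lra.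
have l2 : cabs l < r2.
  have := cabsD (l - m) m; rewrite subrK; move: lm2; lra.
have al : annulus l by apply/andP; split; [exact: lt_trans l1|exact: lt_trans r2e].
have [l0 r10] : 0 < cabs l /\ 0 < r1 by split; [exact: annulus_gt0|exact: lt_trans r11].
have /andP[_ lq] := annulus_out al; have /andP[_ lp] := annulus_in al.
split=> //; apply: (le_trans (laurent_le aM al)).
apply: ler_wpDr => //; apply: lerD; rewrite ler_wpM2l// lef_pV2 ?posrE ?subr_gt0//.
  by rewrite lerD2l lerN2 ler_wpM2r ?invr_ge0 ?(ltW e0) ?(ltW l2).
by rewrite lerD2l lerN2 lef_pV2 ?posrE// ltW.
Qed.

Lemma laurent_continuous M a m : growth M a -> annulus m ->
  (laurent a : R[i]^o -> sumsp XX) l @[l --> (m : R[i]^o)] --> laurent a m.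
Proof.
move=> aM am; have [M' [b [bM bE]]] := laurent_divided_difference aM am.
have [K [d [K0 d0 Kd]]] := laurent_bounded_near bM am.
apply: (@cvg_rnormP _ _ _ (nbhs (m : R[i]^o)) _ _ _).2 => e e0.
have dK : 0 < Num.min d (e / K) by rewrite lt_min d0 divr_gt0.
have /cvg_rnormP/(_ _ dK) : (fun x : R[i]^o => x) @ (m : R[i]^o) --> (m : R[i]^o).
  exact: cvg_id.
apply: filterS => l.
rewrite rnormB lt_min => /andP[ld lK]; have [al lb] := Kd l ld.
rewrite rnormB bE// rnormZ (le_lt_trans (ler_wpM2l (cabs_ge0 _) lb))//.
by rewrite -ltr_pdivlMr.
Qed.

End LaurentCalculus.

Section LaurentDerivable.
Variables (R : realType) (XX : compatible_couple R).
Implicit Types (a b : int -> sumsp XX) (z : R[i]).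

Lemma cexp_difference_quotient z :
  ((h : R[i]^o)^-1 * (cexp (h + z) - cexp z) : R[i]^o) @[h --> (0 : R[i]^o)^'] -->
    (cexp z : R[i]^o).
Proof.
apply: (@cvg_rnormP _ _ _ ((0 : R[i]^o)^') _ _ _).2 => e e0.
pose c := cabs (cexp z).
have c0 : 0 < c by rewrite cabs_gt0 cexp_neq0.
have ec : 0 < e / (2 * c) by rewrite divr_gt0// mulr_gt0.
have [d d0 dP] := cexp_estimate ec.
rewrite near_withinE.
have /cvg_rnormP/(_ _ d0) : (fun x : R[i]^o => x) @ (0 : R[i]^o) --> (0 : R[i]^o).
  exact: cvg_id.
apply: filterS => h; rewrite sub0r rnormN => /dP he h0.
have -> : cexp z - h^-1 * (cexp (h + z) - cexp z) =
    - (cexp z * h^-1 * (cexp h - 1 - h)).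
  by rewrite cexpD; field.
rewrite (rnormN (_ : R[i]^o)) (cabsM _ (cexp h - 1 - h)) (cabsM (cexp z)) cabsV -/c.
have hh : 0 < cabs h by rewrite cabs_gt0.
apply: (@le_lt_trans _ _ (c * (cabs h)^-1 * (e / (2 * c) * cabs h))).
  by rewrite ler_wpM2l// mulr_ge0 ?invr_ge0 ?ltW.
have -> : c * (cabs h)^-1 * (e / (2 * c) * cabs h) = e / 2.
  by field; rewrite !gt_eqF.
lra.
Qed.

Lemma cexp_cvg0 z :
  (cexp (h + z) : R[i]^o) @[h --> (0 : R[i]^o)^'] --> (cexp z : R[i]^o).
Proof.
apply: (@cvg_rnormP _ _ _ ((0 : R[i]^o)^') _ _ _).2 => e e0.
pose c := cabs (cexp z).
have c0 : 0 < c by rewrite cabs_gt0 cexp_neq0.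
have [d d0 dP] := @cexp_estimate R 1 ltr01.
have d'0 : 0 < Num.min d (e / (2 * c)) by rewrite lt_min d0 divr_gt0// mulr_gt0.
rewrite near_withinE.
have /cvg_rnormP/(_ _ d'0) : (fun x : R[i]^o => x) @ (0 : R[i]^o) --> (0 : R[i]^o).
  exact: cvg_id.
apply: filterS => h; rewrite sub0r rnormN lt_min => /andP[/dP he hc] h0.
rewrite rnormB cexpD -{2}(mul1r (cexp z)) -mulrBl cabsM -/c.
rewrite -ltr_pdivlMr// -(subrK h (cexp h - 1)).
apply: (le_lt_trans (cabsD _ _)); rewrite mul1r in he.
rewrite (le_lt_trans (lerD he (lexx _)))//.
by rewrite -mulr2n -mulr_natl -ltr_pdivlMl// mulrCA -invfM.
Qed.

(** The difference quotient of [laurent a] composed with [cexp] is that of [cexp]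
    times the divided difference of [laurent a], and both factors converge. *)
Lemma derivable_laurent_cexp M a z : growth M a -> annulus (cexp z) ->
  derivable ((fun z => laurent a (cexp z)) : R[i]^o -> sumsp XX) z 1.
Proof.
move=> aM am; have [M' [b [bM bE]]] := laurent_divided_difference aM am.
have [K [d [K0 d0 Kd]]] := laurent_bounded_near bM am.
apply: (cvgP (cexp z *: laurent b (cexp z))).
have L : (laurent b (cexp (h + z))) @[h --> (0 : R[i]^o)^'] --> laurent b (cexp z).
  exact: (cvg_comp (fun h : R[i]^o => cexp (h + z) : R[i]^o) (laurent b : R[i]^o -> _)
           (@cexp_cvg0 z) (laurent_continuous bM am)).
have FF : Filter ((0 : R[i]^o)^') by exact: within_filter.
have H := cvgZ (@cexp_difference_quotient z) L.
refine (cvg_trans (near_eq_cvg _) (H FF)).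
have /cvg_rnormP/(_ _ d0) := @cexp_cvg0 z.
apply: filterS => h; rewrite rnormB => /Kd[al _] /=.
by rewrite [h%:A]mulr1 bE// scalerA.
Qed.

End LaurentDerivable.

(** * Riemann integrals and trigonometric series *)

Section RiemannIntegral.
Variables (R : realType) (W : normedModType R[i]) (a b : R).
Hypothesis ab : a < b.
Implicit Types (h g : R -> W) (I J : W).

Definition tagged_partition (d : R) (n : nat) (p tag : nat -> R) : Prop :=
  [/\ p 0%N = a, p n = b & forall j, (j < n)%N ->
        p j <= tag j <= p j.+1 /\ p j.+1 - p j < d].

Lemma tagged_partition_exists d : 0 < d ->
  exists n p tag, tagged_partition d n p tag.
Proof.
move=> d0; have ab0 : 0 < b - a by rewrite subr_gt0.
have [n _ nP] := near_infty_natSinv_lt (PosNum (divr_gt0 d0 ab0)).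
have {}nP := nP n (leqnn n); rewrite /= in nP.
pose p (j : nat) := a + j%:R * (n.+1%:R^-1 * (b - a)).
have step j : p j.+1 - p j = n.+1%:R^-1 * (b - a).
  by rewrite /p -natr1; ring.
have n0 : 0 < n.+1%:R^-1 :> R by rewrite invr_gt0.
exists n.+1, p, p; split.
- by rewrite /p mul0r addr0.
- by rewrite /p mulrA mulfV ?pnatr_eq0// mul1r addrC subrK.
- move=> j _; rewrite step lexx/= -ltr_pdivlMr//; split=> //.
  by rewrite -subr_ge0 step mulr_ge0 ?ltW.
Qed.

Lemma partition_le d n p tag j : tagged_partition d n p tag -> (j < n)%N ->
  0 <= p j.+1 - p j.
Proof. by move=> [_ _ H] /H[/andP[+ +] _]; rewrite subr_ge0; exact: le_trans. Qed.

Lemma partition_sum_le d n p tag (y : nat -> W) e : tagged_partition d n p tag ->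
  (forall j, (j < n)%N -> rnorm (y j) <= e * (p j.+1 - p j)) ->
  rnorm (\sum_(0 <= j < n) y j) <= e * (b - a).
Proof.
move=> [p0 pn _] ye; apply: (le_trans (rnorm_sum _ _ _)).
rewrite -pn -p0 -(telescope_sumr p (leq0n n)) mulr_sumr.
by rewrite !big_mkord; apply: ler_sum => j _; exact: ye.
Qed.

Lemma is_Rint_unique h I J : is_Rint a b h I -> is_Rint a b h J -> I = J.
Proof.
move=> hI hJ; apply/eqP; rewrite -subr_eq0; apply/eqP/rnorm_eq0/eqP.
rewrite eq_le rnorm_ge0 andbT; apply/ler_addgt0Pr => e e0; rewrite add0r.
have e2 : 0 < e / 2 by rewrite divr_gt0.
have [d1 d10 H1] := hI _ e2; have [d2 d20 H2] := hJ _ e2.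
have d0 : 0 < Num.min d1 d2 by rewrite lt_min d10.
have [n [p [tag [p0 pn pP]]]] := tagged_partition_exists d0.
have := H1 n p tag p0 pn; have := H2 n p tag p0 pn.
set S := \sum_(_ <= _ < _) _ => h2' h1'.
have {h2'}h2 : rnorm (S - J) < e / 2.
  by apply: h2' => j /pP[? +]; rewrite lt_min => /andP[].
have {h1'}h1 : rnorm (S - I) < e / 2.
  by apply: h1' => j /pP[? +]; rewrite lt_min => /andP[].
have -> : I - J = (S - J) - (S - I) by rewrite opprB [RHS]addrC addrA subrK.
by rewrite (le_trans (rnormD _ _))// rnormN [e]splitr lerD ?ltW.
Qed.

Lemma RintE h I : is_Rint a b h I -> Defs.Rint a b h = I.
Proof.
move=> hI; apply: (is_Rint_unique _ hI).
exact: (@xgetI _ 0 [set J | is_Rint a b h J] I hI).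
Qed.

Lemma is_RintD h g I J : is_Rint a b h I -> is_Rint a b g J ->
  is_Rint a b (fun t => h t + g t) (I + J).
Proof.
move=> hI gJ e e0; have e2 : 0 < e / 2 by rewrite divr_gt0.
have [d1 d10 H1] := hI _ e2; have [d2 d20 H2] := gJ _ e2.
exists (Num.min d1 d2); first by rewrite lt_min d10.
move=> n p tag p0 pn pP.
have h1 := H1 n p tag p0 pn; have h2 := H2 n p tag p0 pn.
under eq_bigr do rewrite scalerDr.
rewrite big_split/= opprD addrACA (le_lt_trans (rnormD _ _))//.
rewrite [e]splitr ltrD//; [apply: h1|apply: h2];
  by move=> j /pP[? +]; rewrite lt_min => /andP[].
Qed.

Lemma is_Rint0 : is_Rint a b (fun=> 0 : W) 0.
Proof.
move=> e e0; exists 1 => // n p tag _ _ _.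
by rewrite big1 ?subrr ?rnorm0// => j _; rewrite scaler0.
Qed.

Lemma is_Rint_sum (h : nat -> R -> W) (I : nat -> W) n :
  (forall j, is_Rint a b (h j) (I j)) ->
  is_Rint a b (fun t => \sum_(0 <= j < n) h j t) (\sum_(0 <= j < n) I j).
Proof.
move=> hI; elim: n => [|n IH].
  rewrite big_geq// (_ : (fun t => _) = fun=> 0); first exact: is_Rint0.
  by apply/funext => t; rewrite big_geq.
rewrite big_nat_recr//= (_ : (fun t => _) =
  (fun t => \sum_(0 <= j < n) h j t + h n t)); first exact: is_RintD.
by apply/funext => t; rewrite big_nat_recr.
Qed.

(** The hypothesis bounds the defect on each interval of a tagged partition by a
    small multiple of its length, so the Riemann sums telescope up to the sum of
    these defects. *)
Lemma is_Rint_primitive h (H : R -> W) :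
  (forall e : R, 0 < e -> exists2 d : R, 0 < d & forall p t q : R,
     p <= t <= q -> q - p < d ->
     rnorm (H q - H p - (q - p)%:C *: h t) <= e * (q - p)) ->
  is_Rint a b h (H b - H a).
Proof.
move=> HP e e0; have ab0 : 0 < b - a by rewrite subr_gt0.
have e1 : 0 < e / (2 * (b - a)) by rewrite divr_gt0// mulr_gt0.
have [d d0 dP] := HP _ e1; exists d => // n p tag p0 pn pP.
have tp : tagged_partition d n p tag by split.
rewrite rnormB -pn -p0 -(telescope_sumr (H \o p) (leq0n n)) -sumrB.
apply: (@le_lt_trans _ _ (e / (2 * (b - a)) * (b - a))).
  by apply: (partition_sum_le tp) => j /pP[]; exact: dP.
have -> : e / (2 * (b - a)) * (b - a) = e / 2 by field; rewrite gt_eqF.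
lra.
Qed.

Lemma is_Rint_uniform_limit h I :
  (forall e : R, 0 < e -> exists2 g, is_Rint a b g I &
     forall t, rnorm (h t - g t) <= e) ->
  is_Rint a b h I.
Proof.
move=> HP e e0; have ab0 : 0 < b - a by rewrite subr_gt0.
have e1 : 0 < e / (2 * (b - a)) by rewrite divr_gt0// mulr_gt0.
have e2 : 0 < e / 2 by rewrite divr_gt0.
have [g gI hg] := HP _ e1; have [d d0 dP] := gI _ e2.
exists d => // n p tag p0 pn pP.
have tp : tagged_partition d n p tag by split.
rewrite (_ : _ - I = (\sum_(0 <= j < n) (p j.+1 - p j)%:C *: (h (tag j) - g (tag j)))
    + (\sum_(0 <= j < n) (p j.+1 - p j)%:C *: g (tag j) - I)); last first.
  rewrite addrA -big_split/=; congr (_ - _); apply: eq_bigr => j _.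
  by rewrite -scalerDr subrK.
rewrite (le_lt_trans (rnormD _ _))// [e]splitr ler_ltD//; last exact: dP.
have -> : e / 2 = e / (2 * (b - a)) * (b - a) by field; rewrite gt_eqF.
apply: (partition_sum_le tp) => j jn.
have pj := partition_le tp jn.
by rewrite rnormZ cabs_real ger0_norm// mulrC ler_wpM2r.
Qed.

End RiemannIntegral.

Section TrigonometricSeries.
Variables (R : realType) (W : normedModType R[i]).

Definition expi (t : R) : R[i] := cexp (0 +i* t).

Lemma expiD s t : expi (s + t) = expi s * expi t.
Proof. by rewrite -cexpD; congr cexp; apply/eqP; rewrite eq_complex/= addr0 !eqxx. Qed.

Lemma expiMz (k : int) t : expi (k%:~R * t) = expi t ^ k.
Proof.
rewrite -cexpMz; congr cexp; have -> : k%:~R = (k%:~R : R)%:C :> R[i].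
  by rewrite rmorph_int.
by apply/eqP; rewrite eq_complex/= mul0r mulr0 subr0 mul0r add0r mulrC !eqxx.
Qed.

Lemma cabs_expi t : cabs (expi t) = 1.
Proof. by rewrite rnorm_cexp expR0. Qed.

(** For nonzero [k] the primitive [expi (k t) / (i k)] takes the same value at both
    ends of the period. *)
Lemma is_Rint_expi (k : int) (c : W) :
  is_Rint 0 (2 * pi) (fun t => expi (k%:~R * t) *: c)
    (if k == 0 then (2 * pi)%:C *: c else 0).
Proof.
have pi0 : 0 < 2 * pi :> R by rewrite mulr_gt0// pi_gt0.
have [->|k0] := eqVneq k 0.
  have := @is_Rint_primitive R W 0 (2 * pi) pi0
    (fun t => expi (0%:~R * t) *: c) (fun t => t%:C *: c).
  rewrite scale0r subr0; apply=> e e0; exists 1 => // p t q /andP[pt tq] _.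
  rewrite mul0r /expi cexp0 scale1r -scalerBl -rmorphB/= subrr rnorm0.
  by rewrite mulr_ge0 ?(ltW e0)// subr_ge0 (le_trans pt).
pose w : R[i] := 0 +i* k%:~R.
have w0 : w != 0 by rewrite eq_complex/= negb_and intr_eq0 k0 orbT.
have := @is_Rint_primitive R W 0 (2 * pi) pi0
  (fun t => expi (k%:~R * t) *: c) (fun t => (w^-1 * expi (k%:~R * t)) *: c).
have -> : expi (k%:~R * 0) = 1 by rewrite mulr0; exact: cexp0.
have -> : expi (k%:~R * (2 * pi)) = 1.
  by rewrite expiMz /expi -(add0r (0 +i* _)) cexp_period cexp0 exp1rz.
rewrite subrr; apply=> e e0.
pose e' := e / (rnorm c + 1) .
have c1 : 0 < rnorm c + 1 by rewrite ltr_wpDl// rnorm_ge0.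
have e'0 : 0 < e' by rewrite divr_gt0.
have [d d0 dP] := cexp_estimate e'0.
have cw : 0 < cabs w by rewrite cabs_gt0.
exists (d / cabs w) => [|p t q /andP[pt tq] qpd]; first by rewrite divr_gt0.
(* The difference of the primitive over [p, q] is expanded around the tag [t];
   the error is controlled on either side by [cexp_estimate]. *)
pose E (s : R) := cexp (w * s%:C) - 1 - w * s%:C.
have expiE s : expi (k%:~R * s) = cexp (w * s%:C).
  congr cexp; apply/eqP.
  by rewrite eq_complex/= mul0r mulr0 subr0 mul0r add0r !eqxx.
have shift s : expi (k%:~R * s) = expi (k%:~R * t) * cexp (w * (s - t)%:C).
  by rewrite -expiE -expiD -mulrDr addrC subrK.
rewrite scalerA -!scalerBl rnormZ.
have -> : w^-1 * expi (k%:~R * q) - w^-1 * expi (k%:~R * p) -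
   (q - p)%:C * expi (k%:~R * t) =
   expi (k%:~R * t) * w^-1 * (E (q - t) - E (p - t)).
  by rewrite (shift q) (shift p) /E !rmorphB/=; field.
rewrite (cabsM _ (E _ - E _)) (cabsM (expi _)) cabs_expi mul1r cabsV.
have small s : `|s| <= q - p -> cabs (E s) <= e' * (cabs w * `|s|).
  move=> sqp; rewrite -cabs_real -cabsM; apply: dP.
  rewrite cabsM cabs_real mulrC -ltr_pdivlMr//.
  exact: le_lt_trans qpd.
have Eq := small (q - t); have Ep := small (p - t).
rewrite ger0_norm ?subr_ge0// in Eq; rewrite ler0_norm ?subr_le0// opprB in Ep.
have {}Eq := Eq (lerB (lexx _) pt); have {}Ep := Ep (lerB tq (lexx _)).
apply: (@le_trans _ _ ((cabs w)^-1 * (e' * (cabs w * (q - p))) * rnorm c)).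
  rewrite ler_wpM2r ?rnorm_ge0// ler_wpM2l ?invr_ge0 ?(ltW cw)//.
  apply: (le_trans (cabsD _ _)); rewrite (rnormN (_ : R[i]^o)).
  have -> : e' * (cabs w * (q - p)) =
    e' * (cabs w * (q - t)) + e' * (cabs w * (t - p)) by ring.
  exact: lerD.
have -> : (cabs w)^-1 * (e' * (cabs w * (q - p))) * rnorm c =
   e' * rnorm c * (q - p) by field; rewrite gt_eqF.
rewrite ler_wpM2r ?subr_ge0 ?(le_trans pt)//.
by rewrite /e' mulrAC ler_pdivrMr// ler_wpM2l ?(ltW e0)// lerDl.
Qed.

(** Uniform approximation by partial sums reduces the claim to single exponentials,
    of which only the constant one contributes. *)
Lemma is_Rint_trigonometric_series (y : int -> W) (G : R -> W) (M1 M2 q p : R) :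
  0 <= M1 -> 0 <= M2 -> 0 < q < 1 -> 0 < p < 1 ->
  (forall n : nat, rnorm (y n%:Z) <= M1 * q ^+ n) ->
  (forall n : nat, rnorm (y (- n.+1%:Z)) <= M2 * p ^+ n) ->
  (forall t, has_sum (fun j : int => expi (j%:~R * t) *: y j) (G t)) ->
  is_Rint 0 (2 * pi) G ((2 * pi)%:C *: y 0).
Proof.
move=> M10 M20 /andP[q0 q1] /andP[p0 p1] yq yp yG.
have pi0 : 0 < 2 * pi :> R by rewrite mulr_gt0// pi_gt0.
apply: is_Rint_uniform_limit => // e e0.
have e2 : 0 < e / 2 by rewrite divr_gt0.
have tail (M r : R) : 0 <= M -> 0 < r -> r < 1 ->
    \forall n \near \oo, M * r ^+ n / (1 - r) < e / 2.
  move=> M0 r0 r1; have r1' : `|r| < 1 by rewrite gtr0_norm.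
  have /cvgrPdist_lt/(_ _ e2) := cvg_geometric (M / (1 - r)) r1'.
  apply: filterS => n; rewrite /= sub0r normrN; apply: le_lt_trans.
  by rewrite mulrAC ler_norm.
have [N [/= Nq Np]] := filter_ex (filterI (nbhs_infty_gt 0)
  (filterI (tail _ _ M10 q0 q1) (tail _ _ M20 p0 p1))).
exists (fun t => \sum_(0 <= j < N) expi (j%:Z%:~R * t) *: y j +
   \sum_(0 <= j < N) expi ((- j.+1%:Z)%:~R * t) *: y (- j.+1%:Z)).
  rewrite (_ : _ *: _ = \sum_(0 <= j < N) (if j%:Z == 0 then (2 * pi)%:C *: y j else 0)
    + \sum_(0 <= j < N) 0).
    by apply: is_RintD => //; apply: is_Rint_sum => // j; exact: is_Rint_expi.
  rewrite big1_eq addr0; case: N Nq {Np} => // N _.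
  by rewrite big_nat_recl//= big1 ?addr0.
move=> t; have [u [v [hu hv ->]]] := yG t.
rewrite opprD addrACA [e]splitr (le_trans (rnormD _ _))//.
have [Nq' Np'] := Np.
have nexp k : rnorm (expi (k%:~R * t) *: y k) = rnorm (y k).
  by rewrite rnormZ cabs_expi mul1r.
apply: lerD.
  apply: le_trans (ltW Nq'); apply: (series_tail_le _ M10 q0 q1 _ hu) => n.
  by rewrite nexp.
apply: le_trans (ltW Np'); apply: (series_tail_le _ M20 p0 p1 _ hv) => n.
by rewrite nexp.
Qed.

End TrigonometricSeries.

(** * Hardy functions as Laurent series *)

Section HardyLaurent.
Variables (R : realType) (XX : seq_couple R).
Implicit Types (a b : int -> sumsp XX) (z : R[i]).

(** The coefficient sequences of Hardy functions. Unlike the Fourier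
    coefficients on a line, these and their norm do not refer to any line. *)
Definition laurent_rep a (u0 : ss_sp (sc_S0 XX)) (u1 : ss_sp (sc_S1 XX)) : Prop :=
  forall k,
  in0 (ss_val _ u0 k) = a k /\ in1 (ss_val _ u1 k) = (expR 1)%:C ^ k *: a k.

(** The substitution x_k = e^(kz) a_k absorbs the weights of both spaces. *)
Lemma laurent_repP z a u0 u1 : laurent_rep a u0 u1 <->
  wrep (@in0 R XX) (cexp (- z)) (laurent_term a (cexp z)) u0 /\
  wrep (@in1 R XX) (cexp (1 - z)) (laurent_term a (cexp z)) u1.
Proof.
have z0 := cexp_neq0 z.
have E1 k : cexp (1 - z) ^ k = (expR 1)%:C ^ k * (cexp z ^ k)^-1.
  by rewrite cexpD cexp1 cexpN expfzMl exprz_inv invr_expz.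
have E0 k : cexp (- z) ^ k = (cexp z ^ k)^-1.
  by rewrite cexpN exprz_inv invr_expz.
have zk k : cexp z ^ k != 0 by rewrite expfz_neq0.
have ek k : (expR 1)%:C ^ k != 0 :> R[i].
  by rewrite expfz_neq0// eq_complex/= negb_and gt_eqF// expR_gt0.
split=> [au|[[y0 [uy0 yx0]] [y1 [uy1 yx1]]] k].
  split.
    exists (fun k => cexp z ^ k *: ss_val _ u0 k); split.
      by apply/funext => k; rewrite E0 scalerA mulVf// scale1r.
    by move=> k; rewrite linearZ/= (au k).1.
  exists (fun k => (cexp (1 - z) ^ k)^-1 *: ss_val _ u1 k); split.
    apply/funext => k; rewrite scalerA mulfV ?scale1r//.
    by rewrite expfz_neq0// cexp_neq0.
  move=> k; rewrite linearZ/= (au k).2 scalerA E1 invfM invrK mulrAC.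
  by rewrite mulVf// mul1r.
rewrite uy0 uy1; split.
  by rewrite linearZ/= yx0 [LHS]scalerA E0 mulVf// scale1r.
by rewrite linearZ/= yx1 [LHS]scalerA E1 -mulrA mulVf// mulr1.
Qed.

Lemma laurent_rep_growth a u0 u1 : laurent_rep a u0 u1 ->
  growth (rnorm u0 + rnorm u1) a.
Proof.
move=> au k; have [a0 a1] := au k; split.
  rewrite -a0 (le_trans (rnorm_in0 _))// (le_trans (rnorm_ss_val u0 k))//.
  by rewrite lerDl rnorm_ge0.
have -> : rnorm (a k) * expR 1 ^ k = rnorm ((expR 1)%:C ^ k *: a k).
  by rewrite rnormZ cabs_exprz cabs_real ger0_norm ?expR_ge0// mulrC.
rewrite -a1 (le_trans (rnorm_in1 _))// (le_trans (rnorm_ss_val u1 k))//.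
by rewrite lerDr rnorm_ge0.
Qed.

Lemma laurent_interp_norm_le z a u0 u1 : in_strip z -> laurent_rep a u0 u1 ->
  (interp_norm z (laurent a (cexp z)) <= (l2 (rnorm u0) (rnorm u1))%:E)%E.
Proof.
move=> /cexp_annulus az au; have [r0 r1] := (laurent_repP z a u0 u1).1 au.
exact: (interp_norm_le (laurentP (laurent_rep_growth au) az) r0 r1).
Qed.

Lemma laurent_interp_norm_lt z w (e : \bar R) : in_strip z ->
  (interp_norm z w < e)%E ->
  exists a u0 u1, [/\ laurent_rep a u0 u1, laurent a (cexp z) = w &
    ((l2 (rnorm u0) (rnorm u1))%:E < e)%E].
Proof.
move=> /cexp_annulus az /interp_norm_lt[x [u0 [u1 [xw r0 r1 ue]]]].
pose a k := (cexp z ^ k)^-1 *: x k.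
have ax : laurent_term a (cexp z) = x.
  apply/funext => k; rewrite /laurent_term scalerA mulfV ?scale1r//.
  by rewrite expfz_neq0// cexp_neq0.
have au : laurent_rep a u0 u1 by apply/(laurent_repP z); rewrite ax.
exists a, u0, u1; split=> //.
by apply: (laurentE (laurent_rep_growth au) az); rewrite ax.
Qed.

(** On a vertical line a Laurent series in [cexp] is a normally convergent
    trigonometric series, and multiplying it by [cexp (- i k t)] shifts its
    coefficients. *)
Lemma fourier_laurent M b (g : R[i] -> sumsp XX) z k : growth M b ->
  annulus (cexp z) -> (forall t : R, g (z + (0 +i* t)) = laurent b (cexp (z + (0 +i* t)))) ->
  fourier g z k = laurent_term b (cexp z) k.
Proof.
move=> bM az gb; have M0 := growth_ge0 bM.
have pi0 : 0 < 2 * pi :> R by rewrite mulr_gt0// pi_gt0.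
set y := laurent_term b (cexp z).
have /andP[q0 q1] := annulus_out az; have /andP[p0 p1] := annulus_in az.
have az0 := annulus_gt0 az.
rewrite /fourier (_ : Defs.Rint _ _ _ = (2 * pi)%:C *: y k).
  rewrite scalerA -rmorphM/= mulVf ?gt_eqF//.
  by rewrite [X in X *: _](_ : _ = 1)// scale1r.
apply: (RintE pi0).
pose y' j := y (j + k); have -> : y k = y' 0 by rewrite /y' add0r.
have y'q (n : nat) : rnorm (y' n%:Z) <= M * (cabs (cexp z) / expR 1) ^ k *
    (cabs (cexp z) / expR 1) ^+ n by exact: laurent_term_out.
have y'p (n : nat) : rnorm (y' (- n.+1%:Z)) <= M * (cabs (cexp z)) ^ (k - 1) *
    (cabs (cexp z))^-1 ^+ n by exact: laurent_term_in.
apply: (is_Rint_trigonometric_series _ _ (annulus_out az) (annulus_in az) y'q y'p).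
- by rewrite mulr_ge0// exprz_ge0// ltW.
- by rewrite mulr_ge0// exprz_ge0// ltW.
move=> t; have azt : annulus (cexp (z + (0 +i* t))).
  by rewrite /annulus cexpD cabsM -/(expi t) cabs_expi mulr1.
rewrite gb -/(expi (- (k%:~R * t))).
apply: has_sum_ext (has_sum_shift k (has_sumMl _ (laurentP bM azt))) => j.
rewrite /y' /y /laurent_term [LHS]scalerA [RHS]scalerA.
suff -> : expi (- (k%:~R * t)) * cexp (z + (0 +i* t)) ^ (j + k) =
    expi (j%:~R * t) * cexp z ^ (j + k) by [].
have -> : cexp (z + (0 +i* t)) = cexp z * expi t by rewrite cexpD.
have -> : j%:~R * t = - (k%:~R * t) + (j + k)%:~R * t.
  by rewrite rmorphD/=; ring.
have -> : (cexp z * expi t) ^ (j + k) = cexp z ^ (j + k) * expi ((j + k)%:~R * t).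
  by rewrite expiMz expfzMl.
have -> : expi (- (k%:~R * t) + (j + k)%:~R * t) =
    expi (- (k%:~R * t)) * expi ((j + k)%:~R * t) by rewrite expiD.
by move: (expi _) (expi _) (_ ^ _) => x y0 y1; ring.
Qed.

Lemma laurent_hardy z a u0 u1 : in_strip z -> laurent_rep a u0 u1 ->
  let f := fun x => laurent a (cexp x) in
  hardy z f /\ hardy_norm z f = (l2 (rnorm u0) (rnorm u1))%:E.
Proof.
move=> sz au f; have aM := laurent_rep_growth au.
have fE : fourier f z = laurent_term a (cexp z).
  by apply/funext => k; apply: (fourier_laurent _ aM) => //; exact: cexp_annulus.
have [r0 r1] := (laurent_repP z a u0 u1).1 au.
have nE : hardy_norm z f = (l2 (rnorm u0) (rnorm u1))%:E.
  by rewrite /hardy_norm fE; exact: couple_norm_rep.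
split; last exact: nE.
split; last by rewrite nE ltry.
  by move=> x sx; exact: (derivable_laurent_cexp aM (cexp_annulus sx)).
by move=> x _; rewrite /f cexp_period.
Qed.

Lemma in_strip_near z : in_strip z -> \forall h \near (0 : R[i]^o)^', in_strip (h + z).
Proof.
move=> /andP[z0 z1]; rewrite near_withinE.
have d0 : 0 < Num.min (complex.Re z) (1 - complex.Re z) by rewrite lt_min z0 subr_gt0.
have /cvg_rnormP/(_ _ d0) : (fun x : R[i]^o => x) @ (0 : R[i]^o) --> (0 : R[i]^o).
  exact: cvg_id.
apply: filterS => h; rewrite sub0r rnormN lt_min => /andP[h0 h1] _.
have [x [y Eh]] : exists x y : R, h = x +i* y by case: (h) => x y; exists x, y.
have := Re_le_cabs h; rewrite {1}Eh/= ler_norml => /andP[xh hx].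
rewrite /in_strip Eh; case: (z) z0 z1 h0 h1 => zx zy /= z0 z1 h0 h1.
by apply/andP; split; lra.
Qed.

Lemma cexp_isolated z : \forall h \near (0 : R[i]^o)^', cexp (h + z) != cexp z.
Proof.
have half0 : 0 < (2^-1 : R) by rewrite invr_gt0.
have [d d0 dP] := @cexp_estimate R _ half0; rewrite near_withinE.
have /cvg_rnormP/(_ _ d0) : (fun x : R[i]^o => x) @ (0 : R[i]^o) --> (0 : R[i]^o).
  exact: cvg_id.
apply: filterS => h; rewrite sub0r rnormN => /dP hh h0; apply/eqP.
rewrite cexpD -[RHS]mul1r => /(mulIf (cexp_neq0 z)) h1.
move: hh; rewrite h1 subrr sub0r (rnormN (h : R[i]^o)).
have : 0 < cabs h by rewrite cabs_gt0.
lra.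
Qed.

(** By continuity, since the zeros of [cexp - cexp s] are isolated. *)
Lemma laurent_identity M b (g : R[i] -> sumsp XX) (s : R[i]) z : growth M b ->
  (forall z, in_strip z -> derivable (g : R[i]^o -> sumsp XX) z 1) ->
  (forall z, in_strip z -> cexp z != cexp s -> g z = laurent b (cexp z)) ->
  in_strip z -> g z = laurent b (cexp z).
Proof.
move=> bM gd gb sz; have [zs|] := eqVneq (cexp z) (cexp s); last exact: gb.
have FF : ProperFilter ((0 : R[i]^o)^') by exact: Proper_dnbhs_numFieldType.
have L : laurent b (cexp (h + z)) @[h --> (0 : R[i]^o)^'] --> laurent b (cexp z).
  exact: (cvg_comp (fun h : R[i]^o => cexp (h + z) : R[i]^o) (laurent b : R[i]^o -> _)
           (@cexp_cvg0 _ z) (laurent_continuous bM (cexp_annulus sz))).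
have G : g (h + z) @[h --> (0 : R[i]^o)^'] --> g z.
  have /derivable1_diffP/differentiable_continuous gc := gd z sz.
  apply: (cvg_comp (fun h : R[i]^o => h + z : R[i]^o) (g : R[i]^o -> _) _ gc).
  apply: (@cvg_rnormP _ _ _ ((0 : R[i]^o)^') _ _ _).2 => e e0; rewrite near_withinE.
  have /cvg_rnormP/(_ _ e0) : (fun x : R[i]^o => x) @ (0 : R[i]^o) --> (0 : R[i]^o).
    exact: cvg_id.
  by apply: filterS => h he _; rewrite opprD addrCA subrr addr0 -sub0r.
apply/eqP; rewrite -subr_eq0; apply/eqP/rnorm_eq0/eqP.
rewrite eq_le rnorm_ge0 andbT; apply/ler_addgt0Pr => e e0; rewrite add0r.
have e2 : 0 < e / 2 by rewrite divr_gt0.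
have := filterI (cexp_isolated z) (filterI (in_strip_near sz)
  (filterI ((@cvg_rnormP _ _ _ _ _ _ _).1 L _ e2) ((@cvg_rnormP _ _ _ _ _ _ _).1 G _ e2))).
move=> /(_ FF FF FF FF FF)/filter_ex[h [/= hz [hs [Lh Gh]]]].
rewrite zs in hz; rewrite (gb _ hs hz) in Gh.
rewrite -(subrK (laurent b (cexp (h + z))) (g z)) -addrA (le_trans (rnormD _ _))//.
rewrite [e]splitr; apply: lerD; apply: ltW; first exact: Gh.
by rewrite rnormB; exact: Lh.
Qed.

(** The analytic quotient is the Laurent series of [laurent_division], so the
    bound on its Hardy norm is a bound on the coefficients. *)
Lemma division_constant_laurent (z0 s : R[i]) (C : R) a u0 u1 :
  in_strip z0 -> in_strip s -> division_constant XX z0 s C ->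
  laurent_rep a u0 u1 -> laurent a (cexp s) = 0 ->
  exists b v0 v1, [/\ laurent_rep b v0 v1,
    forall l, annulus l -> laurent a l = (l - cexp s) *: laurent b l &
    l2 (rnorm v0) (rnorm v1) <= C * l2 (rnorm u0) (rnorm u1)].
Proof.
move=> sz ss [C0 div] au as0; have aM := laurent_rep_growth au.
have [M [b [bM _ ab]]] := laurent_division aM (cexp_annulus ss) as0.
have [fh fn] := laurent_hardy sz au.
have [g [[gd _ gfin] gf gn]] := div _ fh as0.
have gb z : in_strip z -> g z = laurent b (cexp z).
  apply: (laurent_identity (s := s) bM gd) => {}z zs zns.
  rewrite gf//= ab ?scalerA; last exact: cexp_annulus.
  by rewrite mulVf ?scale1r// subr_eq0.
have gE : fourier g z0 = laurent_term b (cexp z0).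
  apply/funext => k; apply: (fourier_laurent _ bM (cexp_annulus sz)) => t.
  by apply: gb; move: sz; rewrite /in_strip; case: (z0) => x y /=; rewrite addr0.
have [v0 [v1 [r0 r1]]] := couple_norm_lty gfin; rewrite gE in r0 r1.
exists b, v0, v1; split=> //; first exact/(laurent_repP z0).
by move: gn; rewrite fn /hardy_norm gE (couple_norm_rep r0 r1) -EFinM lee_fin.
Qed.

End HardyLaurent.

(** * Completeness of the interpolation spaces *)

Section LaurentRepLinear.
Variables (R : realType) (XX : seq_couple R).
Implicit Types (a b : int -> sumsp XX) (l : R[i]).

Lemma l2_le_add (x y : R) : 0 <= x -> 0 <= y -> l2 x y <= x + y.
Proof.
move=> x0 y0; have := l2D x 0 0 y; rewrite addr0 add0r.
by rewrite /l2 expr0n/= addr0 add0r !sqrtr_sqr !ger0_norm.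
Qed.

Lemma l2_rnormD (V W : normedModType R[i]) (u0 v0 : V) (u1 v1 : W) :
  l2 (rnorm (u0 + v0)) (rnorm (u1 + v1)) <=
    l2 (rnorm u0) (rnorm u1) + l2 (rnorm v0) (rnorm v1).
Proof.
apply: le_trans (l2D _ _ _ _).
by apply: l2_le; apply/andP; split; rewrite ?rnorm_ge0 ?rnormD.
Qed.

Lemma l2_rnormZ (V W : normedModType R[i]) (c : R[i]) (u : V) (v : W) :
  l2 (rnorm (c *: u)) (rnorm (c *: v)) = rnorm c * l2 (rnorm u) (rnorm v).
Proof. by rewrite !rnormZ l2Z// cabs_ge0. Qed.

Lemma laurent_repD a b u0 u1 v0 v1 : laurent_rep a u0 u1 -> laurent_rep b v0 v1 ->
  laurent_rep (fun k => a k + b k) (u0 + v0) (u1 + v1).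
Proof.
move=> au bv k; have [a0 a1] := au k; have [b0 b1] := bv k.
have -> : ss_val _ (u0 + v0) k = ss_val _ u0 k + ss_val _ v0 k by rewrite linearD.
have -> : ss_val _ (u1 + v1) k = ss_val _ u1 k + ss_val _ v1 k by rewrite linearD.
by split; rewrite linearD/= ?a0 ?b0// a1 b1 scalerDr.
Qed.

Lemma laurent_repZ c a u0 u1 : laurent_rep a u0 u1 ->
  laurent_rep (fun k => c *: a k) (c *: u0) (c *: u1).
Proof.
move=> au k; have [a0 a1] := au k.
have -> : ss_val _ (c *: u0) k = c *: ss_val _ u0 k by rewrite linearZ.
have -> : ss_val _ (c *: u1) k = c *: ss_val _ u1 k by rewrite linearZ.
split; first by rewrite linearZ/= a0.
by rewrite linearZ/= a1 [LHS]scalerA [RHS]scalerA [in RHS]mulrC.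
Qed.

Lemma laurent_repB a b u0 u1 v0 v1 : laurent_rep a u0 u1 -> laurent_rep b v0 v1 ->
  laurent_rep (fun k => a k - b k) (u0 - v0) (u1 - v1).
Proof.
move=> au bv; have := laurent_repD au (laurent_repZ (-1) bv).
rewrite !scaleN1r; congr laurent_rep.
by apply/funext => k; rewrite scaleN1r.
Qed.

Lemma laurentD M N a b l : growth M a -> growth N b -> annulus l ->
  laurent (fun k => a k + b k) l = laurent a l + laurent b l.
Proof.
move=> aM bN al; have ab : growth (M + N) (fun k => a k + b k).
  move=> k; have [a1 a2] := aM k; have [b1 b2] := bN k; split.
    by rewrite (le_trans (rnormD _ _))// lerD.
  rewrite (le_trans (ler_wpM2r _ (rnormD _ _))) ?exprz_ge0 ?expR_ge0//.
  by rewrite mulrDl lerD.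
apply: (laurentE ab al).
apply: has_sum_ext (has_sumD (laurentP aM al) (laurentP bN al)) => k.
by rewrite /laurent_term [RHS]scalerDr.
Qed.

Lemma laurentZ M c a l : growth M a -> annulus l ->
  laurent (fun k => c *: a k) l = c *: laurent a l.
Proof.
move=> aM al; have ca : growth (cabs c * M) (fun k => c *: a k).
  move=> k; have [a1 a2] := aM k.
  by rewrite rnormZ -mulrA; split; rewrite ler_wpM2l// cabs_ge0.
apply: (laurentE ca al); apply: has_sum_ext (has_sumMl c (laurentP aM al)) => k.
by rewrite /laurent_term [LHS]scalerA [RHS]scalerA [in LHS]mulrC.
Qed.

Lemma laurent_rep_sum (a : nat -> int -> sumsp XX) u0 u1 n :
  (forall j, laurent_rep (a j) (u0 j) (u1 j)) ->
  laurent_rep (fun k => series (fun j => a j k) n) (series u0 n) (series u1 n).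
Proof.
move=> au; elim: n => [|n IH] k.
  have E0 : ss_val (sc_S0 XX) 0 k = 0 by rewrite linear0.
  have E1 : ss_val (sc_S1 XX) 0 k = 0 by rewrite linear0.
  by rewrite /series/= !big_geq// E0 E1 !linear0.
have := laurent_repD IH (au n) k.
by rewrite /series/= !big_nat_recr.
Qed.

(** The relation that couples the two components is tested coordinate by
    coordinate, and coordinates are continuous on both sequence structures. *)
Lemma laurent_rep_closed (u0 : nat -> ss_sp (sc_S0 XX)) (u1 : nat -> ss_sp (sc_S1 XX))
    v0 v1 (a : nat -> int -> sumsp XX) :
  (forall n, laurent_rep (a n) (u0 n) (u1 n)) ->
  u0 @ \oo --> v0 -> u1 @ \oo --> v1 ->
  laurent_rep (fun k => in0 (ss_val _ v0 k)) v0 v1.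
Proof.
move=> au /cvg_rnormP c0 /cvg_rnormP c1 k; split=> //.
apply/eqP; rewrite -subr_eq0; apply/eqP/rnorm_eq0/eqP.
rewrite eq_le rnorm_ge0 andbT; apply/ler_addgt0Pr => e e0; rewrite add0r.
pose m := (expR 1 : R) ^ k; have m0 : 0 < m by rewrite exprz_gt0// expR_gt0.
have e2 : 0 < e / 2 by rewrite divr_gt0.
have em : 0 < e / 2 / m by rewrite divr_gt0.
have [n [n0 n1]] := filter_ex (filterI (c0 _ em) (c1 _ e2)).
have [a0 a1] := au n k.
have -> : in1 (ss_val _ v1 k) - (expR 1)%:C ^ k *: in0 (ss_val _ v0 k) =
    in1 (ss_val _ (v1 - u1 n) k) - (expR 1)%:C ^ k *: in0 (ss_val _ (v0 - u0 n) k).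
  have -> : ss_val _ (v1 - u1 n) k = ss_val _ v1 k - ss_val _ (u1 n) k.
    by rewrite linearB.
  have -> : ss_val _ (v0 - u0 n) k = ss_val _ v0 k - ss_val _ (u0 n) k.
    by rewrite linearB.
  rewrite (linearB (@in1 R XX)) (linearB (@in0 R XX))/= a0 a1 scalerBr.
  by rewrite opprB addrA subrK.
rewrite (le_trans (rnormD _ _))// rnormN rnormZ cabs_exprz cabs_real.
rewrite ger0_norm ?expR_ge0// -/m [e]splitr; apply: lerD; apply: ltW.
  by apply: le_lt_trans n1; rewrite (le_trans (rnorm_in1 _))// rnorm_ss_val.
rewrite mulrC -ltr_pdivlMr//; apply: le_lt_trans n0.
by rewrite (le_trans (rnorm_in0 _))// rnorm_ss_val.
Qed.

End LaurentRepLinear.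

Section InterpComplete.
Variables (R : realType) (XX : seq_couple R) (z : strip R).
Local Notation X := (interp_sp XX z).

Lemma rnorm_interp (w : X) : (rnorm w)%:E = interp_norm z (interp_val w).
Proof. exact: interp_sp_normE. Qed.

Lemma interp_val_series (y : nat -> X) n :
  interp_val (series y n) = series (fun n => interp_val (y n)) n.
Proof.
rewrite /series/=; elim: n => [|n IH]; first by rewrite !big_geq.
by rewrite !big_nat_recr//= -IH.
Qed.

(** The terms of a geometrically small series in X_z lift to geometrically small
    Laurent sequences; these are summed in the two complete sequence spaces, and
    the value of the sum at [z] is the limit. *)
Lemma interp_series_cvg (y : nat -> X) : (forall n, rnorm (y n) <= 2^-1 ^+ n) ->
  exists v : X, series y @ \oo --> v.
Proof.
move=> yM; have sz := stripP z; have az := cexp_annulus sz.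
have half0 : 0 < (2^-1 : R) by rewrite invr_gt0.
have half1 : (2^-1 : R) < 1 by rewrite invf_lt1// ltr1n.
have lift n : exists p : (int -> sumsp XX) * (ss_sp (sc_S0 XX) * ss_sp (sc_S1 XX)),
    [/\ laurent_rep p.1 p.2.1 p.2.2, laurent p.1 (cexp z) = interp_val (y n) &
        l2 (rnorm p.2.1) (rnorm p.2.2) <= 2 * 2^-1 ^+ n].
  have : (interp_norm z (interp_val (y n)) < (2 * 2^-1 ^+ n)%:E)%E.
    rewrite -rnorm_interp lte_fin (le_lt_trans (yM n))// ltr_pMl ?exprn_gt0//.
    by rewrite ltr1n.
  move=> /(laurent_interp_norm_lt sz)[a [u0 [u1 [au az' lt]]]].
  by exists (a, (u0, u1)); split=> //=; rewrite ltW// -lte_fin.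
have {lift}[p pP] := choice lift.
pose a n := (p n).1; pose u0 n := (p n).2.1; pose u1 n := (p n).2.2.
have au n : laurent_rep (a n) (u0 n) (u1 n) by have [] := pP n.
have aE n : laurent (a n) (cexp z) = interp_val (y n) by have [] := pP n.
have u0M n : rnorm (u0 n) <= 2 * 2^-1 ^+ n.
  by have [_ _] := pP n; apply: le_trans; exact: le_l2_l.
have u1M n : rnorm (u1 n) <= 2 * 2^-1 ^+ n.
  by have [_ _] := pP n; apply: le_trans; exact: le_l2_r.
have two0 : 0 <= 2 :> R by [].
have [v0 c0] := geometric_series_cvg two0 half0 half1 u0M.
have [v1 c1] := geometric_series_cvg two0 half0 half1 u1M.
have Sau n := laurent_rep_sum n au.
pose A k := in0 (ss_val (sc_S0 XX) v0 k).
have Av : laurent_rep A v0 v1 := laurent_rep_closed Sau c0 c1.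
have Ain : laurent A (cexp z) \in interp_pred z.
  exact: le_lt_trans (laurent_interp_norm_le sz Av) (ltry _).
have SE n : laurent (fun k => series (fun j => a j k) n) (cexp z) =
    interp_val (series y n).
  rewrite interp_val_series; elim: n => [|n IH].
    rewrite [RHS]big_geq// -(scale0r (laurent (a 0%N) (cexp z))).
    rewrite -(laurentZ 0 (laurent_rep_growth (au 0%N)) az); congr laurent.
    by apply/funext => k; rewrite scale0r /series/= big_geq.
  rewrite [RHS]big_nat_recr//= -aE -[X in X + _]IH.
  rewrite -(laurentD (laurent_rep_growth (Sau n)) (laurent_rep_growth (au n)) az).
  by congr laurent; apply/funext => k; rewrite /series/= big_nat_recr.
exists (InterpSp Ain); apply/cvg_rnormP => e e0.
have e2 : 0 < e / 2 by rewrite divr_gt0.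
have /cvg_rnormP/(_ _ e2) := c0; have /cvg_rnormP/(_ _ e2) := c1.
apply: filterS2 => n h1 h0; rewrite -lte_fin rnorm_interp.
have -> : interp_val (InterpSp Ain - series y n) =
    laurent (fun k => A k - series (fun j => a j k) n) (cexp z).
  have -> : (fun k => A k - series (fun j => a j k) n) =
      (fun k => A k + -1 *: series (fun j => a j k) n).
    by apply/funext => k; rewrite scaleN1r.
  rewrite (laurentD (laurent_rep_growth Av)
    (laurent_rep_growth (laurent_repZ (-1) (Sau n))) az).
  by rewrite (laurentZ _ (laurent_rep_growth (Sau n)) az) SE scaleN1r.
apply: (le_lt_trans (laurent_interp_norm_le sz (laurent_repB Av (Sau n)))).
rewrite lte_fin (le_lt_trans (l2_le_add (rnorm_ge0 _) (rnorm_ge0 _)))//.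
by rewrite [e]splitr ltrD.
Qed.

HB.instance Definition _ :=
  Uniform_isComplete.Build X (complete_of_series interp_series_cvg).

End InterpComplete.

(** * Gluing two quotients of one space *)

(** A joint presentation of two Banach spaces as quotients of one space [H]:
    [joint x y r] is to be read as the existence of an element of [H] of norm at
    most [r] that lifts both [x] and [y]. In the last two bounds [joint_gap]
    measures how far the two quotient norms are from each other on [H]. *)
Record joint_quotient (R : realType) (X Y : normedModType R[i]) := JointQuotient {
  joint : X -> Y -> R -> Prop;
  joint_gap : R;
  joint_gap_gt0 : 0 < joint_gap;
  jointD : forall x y r x' y' r',
    joint x y r -> joint x' y' r' -> joint (x + x') (y + y') (r + r');
  jointZ : forall (c : R[i]) x y r,
    joint x y r -> joint (c *: x) (c *: y) (rnorm c * r);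
  joint_lift_l : forall x (e : R), 0 < e -> exists y, joint x y (rnorm x + e);
  joint_lift_r : forall y (e : R), 0 < e -> exists x, joint x y (rnorm y + e);
  joint_le_l : forall x y r, joint x y r -> rnorm x <= r;
  joint_le_r : forall x y r, joint x y r -> rnorm y <= r;
  joint_gap_l : forall x y r, joint x y r -> rnorm x <= rnorm y + joint_gap * r;
  joint_gap_r : forall x y r, joint x y r -> rnorm y <= rnorm x + joint_gap * r }.

(** The carrier carries its joint presentation along, since the norm depends on
    it. *)
Definition glue_space (R : realType) (X Y : normedModType R[i])
  (Q : joint_quotient X Y) : Type := (X * Y)%type.

Section Glue.
Variables (R : realType) (X Y : completeNormedModType R[i]).
Variable Q : joint_quotient X Y.
Local Notation d := (joint_gap Q).

Lemma joint0 : joint Q 0 0 0.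
Proof.
have [y /(jointZ 0)] := joint_lift_l Q 0 ltr01.
by rewrite !scale0r /rnorm normr0 mul0r.
Qed.

Lemma joint_ge0 x y r : joint Q x y r -> 0 <= r.
Proof. by move=> /joint_le_l; apply: le_trans; exact: rnorm_ge0. Qed.

Local Notation glue := (glue_space Q).

HB.instance Definition _ := GRing.Lmodule.copy glue (X * Y)%type.

Definition glue_set (z : glue) : set R :=
  [set s | exists x y r, joint Q x y r /\
     s = rnorm (z.1 - x) + rnorm (z.2 + y) + d * r].

(** The largest seminorm below the sum norm for which [(x, - y)] has size at most
    [d * r] whenever [x] and [y] have a common lift of norm [r]. *)
Definition glue_norm (z : glue) : R := inf (glue_set z).

Lemma glue_set_has_inf z : has_inf (glue_set z).
Proof.
split.
  by exists (rnorm (z.1 - 0) + rnorm (z.2 + 0) + d * 0), 0, 0, 0; split=> //; exact: joint0.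
exists 0 => _ [x [y [r [/joint_ge0 r0 ->]]]].
by rewrite !addr_ge0 ?rnorm_ge0// mulr_ge0// ltW// joint_gap_gt0.
Qed.

Lemma glue_norm_le z x y r : joint Q x y r ->
  glue_norm z <= rnorm (z.1 - x) + rnorm (z.2 + y) + d * r.
Proof.
move=> xy; apply: ge_inf; first by case: (glue_set_has_inf z).
by exists x, y, r.
Qed.

Lemma glue_norm_adherent z (e : R) : 0 < e -> exists x y r, joint Q x y r /\
  rnorm (z.1 - x) + rnorm (z.2 + y) + d * r < glue_norm z + e.
Proof.
move=> e0; have [_ [x [y [r [xy ->]]]] lt] := inf_adherent e0 (glue_set_has_inf z).
by exists x, y, r.
Qed.

Lemma glue_norm_ge z s : (forall x y r, joint Q x y r ->
  s <= rnorm (z.1 - x) + rnorm (z.2 + y) + d * r) -> s <= glue_norm z.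
Proof.
move=> H; apply: lb_le_inf; first by case: (glue_set_has_inf z).
by move=> _ [x [y [r [xy ->]]]]; exact: H.
Qed.

Lemma glue_norm_le_sum z : glue_norm z <= rnorm z.1 + rnorm z.2.
Proof. by have := glue_norm_le z joint0; rewrite subr0 !addr0 mulr0 addr0. Qed.

Lemma glue_norm_ge0 z : 0 <= glue_norm z.
Proof.
apply: glue_norm_ge => x y r /joint_ge0 r0.
by rewrite !addr_ge0 ?rnorm_ge0// mulr_ge0// ltW// joint_gap_gt0.
Qed.

(** As the gap is positive the new norm is equivalent to the sum norm. *)
Lemma sum_le_glue_norm z : rnorm z.1 + rnorm z.2 <= (1 + 2 / d) * glue_norm z.
Proof.
have d0 := joint_gap_gt0 Q.
have c0 : 0 < 1 + 2 / d by rewrite addr_gt0// divr_gt0.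
rewrite -ler_pdivrMl//; apply: glue_norm_ge => x y r xy.
rewrite ler_pdivrMl//; have r0 := joint_ge0 xy.
have zx : rnorm z.1 <= rnorm (z.1 - x) + r.
  rewrite -{1}(subrK x z.1) (le_trans (rnormD _ _))// lerD2l.
  exact: joint_le_l xy.
have zy : rnorm z.2 <= rnorm (z.2 + y) + r.
  rewrite -{1}(addrK y z.2) (le_trans (rnormD _ _))// lerD2l rnormN.
  exact: joint_le_r xy.
apply: (le_trans (lerD zx zy)); rewrite mulrDl mul1r.
have -> : rnorm (z.1 - x) + r + (rnorm (z.2 + y) + r) =
  rnorm (z.1 - x) + rnorm (z.2 + y) + 0 + 2 / d * (d * r).
  by field; rewrite gt_eqF.
rewrite lerD ?lerD ?mulr_ge0 ?(ltW d0)//.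
by rewrite ler_wpM2l ?divr_ge0 ?(ltW d0)// lerDr addr_ge0 ?rnorm_ge0.
Qed.

Lemma glue_normD (z w : glue) :
  (glue_norm (z + w))%:C <= (glue_norm z)%:C + (glue_norm w)%:C.
Proof.
rewrite -rmorphD/= lecR; apply/ler_addgt0Pr => e e0.
have e2 : 0 < e / 2 by rewrite divr_gt0.
have [x [y [r [xy lt]]]] := glue_norm_adherent z e2.
have [x' [y' [r' [xy' lt']]]] := glue_norm_adherent w e2.
apply: (le_trans (glue_norm_le (z + w) (jointD xy xy'))).
have -> : (z + w).1 - (x + x') = (z.1 - x) + (w.1 - x') by rewrite opprD addrACA.
have -> : (z + w).2 + (y + y') = (z.2 + y) + (w.2 + y') by rewrite addrACA.
have := rnormD (z.1 - x) (w.1 - x'); have := rnormD (z.2 + y) (w.2 + y').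
by rewrite mulrDr; move: lt lt'; lra.
Qed.

Lemma glue_norm_Z_le (c : R[i]) z : glue_norm (c *: z) <= rnorm c * glue_norm z.
Proof.
have c0 : 0 <= rnorm c := cabs_ge0 c.
apply/ler_addgt0Pr => e e0.
have e1 : 0 < e / (rnorm c + 1) by rewrite divr_gt0// ltr_wpDl.
have [x [y [r [xy lt]]]] := glue_norm_adherent z e1.
apply: (le_trans (glue_norm_le (c *: z) (jointZ c xy))).
have -> : (c *: z).1 - c *: x = c *: (z.1 - x) by rewrite scalerBr.
have -> : (c *: z).2 + c *: y = c *: (z.2 + y) by rewrite scalerDr.
rewrite !rnormZ mulrCA -!mulrDr.
apply: (le_trans (ler_wpM2l c0 (ltW lt))).
rewrite mulrDr lerD2l mulrCA ler_piMr// ?(ltW e0)//.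
by rewrite ler_pdivrMr ?ltr_wpDl// mul1r lerDl.
Qed.

Lemma glue_normZ (c : R[i]) z : (glue_norm (c *: z))%:C = `|c| * (glue_norm z)%:C.
Proof.
rewrite -cabsE -rmorphM/=; congr (_ %:C).
apply/eqP; rewrite eq_le glue_norm_Z_le/=.
have [->|c0] := eqVneq c 0.
  by rewrite /rnorm normr0 mul0r glue_norm_ge0.
have := glue_norm_Z_le c^-1 (c *: z).
rewrite scalerA mulVf// scale1r cabsV => le.
apply: (le_trans (ler_wpM2l (cabs_ge0 c) le)).
by rewrite mulrA mulfV ?mul1r// gt_eqF// cabs_gt0.
Qed.

Lemma glue_norm_eq0 z : (glue_norm z)%:C = 0 -> z = 0.
Proof.
move=> /complexI z0; have := sum_le_glue_norm z; rewrite z0 mulr0.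
case: z {z0} => x y /= xy.
have x0 : rnorm x = 0.
  by apply/eqP; rewrite eq_le rnorm_ge0 andbT (le_trans _ xy)// lerDl rnorm_ge0.
have y0 : rnorm y = 0.
  by apply/eqP; rewrite eq_le rnorm_ge0 andbT (le_trans _ xy)// lerDr rnorm_ge0.
by rewrite (rnorm_eq0 x0) (rnorm_eq0 y0).
Qed.

HB.instance Definition _ :=
  Lmodule_isNormed.Build R[i] glue glue_normD glue_normZ glue_norm_eq0.

Lemma rnorm_glue (z : glue) : rnorm z = glue_norm z.
Proof. by []. Qed.

Definition glue_l (x : X) : glue := (x, 0).
Definition glue_r (y : Y) : glue := (0, y).

Lemma glue_l_linear : linear glue_l.
Proof. by move=> c x y; congr pair; rewrite /= scaler0 addr0. Qed.

Lemma glue_r_linear : linear glue_r.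
Proof. by move=> c x y; congr pair; rewrite /= scaler0 addr0. Qed.

HB.instance Definition _ := GRing.isLinear.Build R[i] X glue _ glue_l glue_l_linear.
HB.instance Definition _ := GRing.isLinear.Build R[i] Y glue _ glue_r glue_r_linear.

(** The gap bounds are what prevents the identification of [x] with [y] from
    shrinking either of the two original norms. *)
Lemma rnorm_glue_l x : rnorm (glue_l x) = rnorm x.
Proof.
apply/eqP; rewrite eq_le rnorm_glue; apply/andP; split.
  by have := glue_norm_le_sum (glue_l x); rewrite /= rnorm0 addr0.
apply: glue_norm_ge => x' y' r xy /=; rewrite add0r -{1}(subrK x' x).
rewrite (le_trans (rnormD _ _))// -addrA lerD2l.
exact: joint_gap_l xy.
Qed.

Lemma rnorm_glue_r y : rnorm (glue_r y) = rnorm y.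
Proof.
apply/eqP; rewrite eq_le rnorm_glue; apply/andP; split.
  by have := glue_norm_le_sum (glue_r y); rewrite /= rnorm0 add0r.
apply: glue_norm_ge => x' y' r xy /=; rewrite sub0r rnormN -{1}(addrK y' y).
rewrite (le_trans (rnormD _ _))// rnormN [rnorm x' + _]addrC -addrA lerD2l.
exact: joint_gap_r xy.
Qed.

Lemma rnorm_glueB x y r : joint Q x y r ->
  rnorm (glue_l x - glue_r y) <= d * r.
Proof.
move=> xy; rewrite rnorm_glue; apply: (le_trans (glue_norm_le _ xy)).
rewrite /= subr0 sub0r [- y + y]addNr [x - x]subrr.
by rewrite !rnorm0 !add0r.
Qed.

Lemma glue_complete (F : set_system glue) : ProperFilter F -> cauchy F -> cvg F.
Proof.
apply: complete_of_series => y yM; have d0 := joint_gap_gt0 Q.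
pose K := 1 + 2 / d.
have K0 : 0 <= K by rewrite addr_ge0// divr_ge0// ltW.
have half0 : 0 < (2^-1 : R) by rewrite invr_gt0.
have half1 : (2^-1 : R) < 1 by rewrite invf_lt1// ltr1n.
have yK n : rnorm (y n).1 + rnorm (y n).2 <= K * 2^-1 ^+ n.
  by rewrite (le_trans (sum_le_glue_norm _))// ler_wpM2l// -rnorm_glue.
have y1 n : rnorm (y n).1 <= K * 2^-1 ^+ n.
  by rewrite (le_trans _ (yK n))// lerDl rnorm_ge0.
have y2 n : rnorm (y n).2 <= K * 2^-1 ^+ n.
  by rewrite (le_trans _ (yK n))// lerDr rnorm_ge0.
have [v1 c1] := geometric_series_cvg K0 half0 half1 y1.
have [v2 c2] := geometric_series_cvg K0 half0 half1 y2.
exists ((v1, v2) : glue); apply/cvg_rnormP => e e0.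
have e2 : 0 < e / 2 by rewrite divr_gt0.
have /cvg_rnormP/(_ _ e2) := c1; have /cvg_rnormP/(_ _ e2) := c2.
apply: filterS2 => n h2 h1; rewrite rnorm_glue.
apply: (le_lt_trans (glue_norm_le_sum _)); rewrite [e]splitr.
have -> : series y n = (series (fun n => (y n).1) n, series (fun n => (y n).2) n).
  rewrite /series/=; elim: n {h1 h2} => [|n IH]; first by rewrite !big_geq.
  by rewrite !big_nat_recr//= IH.
exact: ltrD.
Qed.

HB.instance Definition _ := Uniform_isComplete.Build glue glue_complete.

End Glue.

Section UnitBalls.
Variables (R : realType) (X Y : normedModType R[i]).

(* A lift of norm at most 1 + e has to be scaled back before its second image
   falls into the unit ball. *)
Lemma joint_unit_ball_l (Q : joint_quotient X Y) (x : X) (e : R) :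
  rnorm x <= 1 -> 0 < e ->
  exists x' y r, [/\ joint Q x' y r, r <= 1 & rnorm (x - x') <= e].
Proof.
move=> x1 e0; have [y xy] := joint_lift_l Q x e0.
pose c := (1 + e)^-1; have e1 : 0 < 1 + e by rewrite addr_gt0.
have c0 : 0 <= c by rewrite invr_ge0 ltW.
have := jointZ c%:C xy; rewrite cabs_real ger0_norm// => cxy.
exists (c%:C *: x), (c%:C *: y), (c * (rnorm x + e)); split=> //.
  by rewrite mulrC ler_pdivrMr// mul1r lerD2r.
have c1 : 0 <= 1 - c by rewrite subr_ge0 invf_le1// lerDl ltW.
rewrite -{1}(scale1r x) -scalerBl -rmorphB/= rnormZ cabs_real ger0_norm//.
rewrite (le_trans (ler_piMr c1 x1))//.
have -> : 1 - c = e / (1 + e) by rewrite /c; field; rewrite gt_eqF.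
by rewrite ler_pdivrMr// mulrDr mulr1 lerDl mulr_ge0// ltW.
Qed.

Definition joint_quotientC (Q : joint_quotient X Y) : joint_quotient Y X.
Proof.
exists (fun y x r => joint Q x y r) (joint_gap Q).
- exact: joint_gap_gt0.
- by move=> *; exact: jointD.
- by move=> *; exact: jointZ.
- exact: joint_lift_r.
- exact: joint_lift_l.
- by move=> y x r; exact: joint_le_r.
- by move=> y x r; exact: joint_le_l.
- by move=> y x r; exact: joint_gap_r.
- by move=> y x r; exact: joint_gap_l.
Defined.

End UnitBalls.

(** A point of one unit ball lifts to norm nearly at most 1, and the other image of
    this lift lies in the other ball within the gap of the point. *)
Lemma kadets_dist_joint_quotient (R : realType) (X Y : completeNormedModType R[i])
    (Q : joint_quotient X Y) :
  (kadets_dist X Y <= (joint_gap Q)%:E)%E.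
Proof.
have d0 := joint_gap_gt0 Q.
apply: (@le_trans _ _ (hausdorff_dist (glue_l Q @` @unit_ball R X)
                                      (glue_r Q @` @unit_ball R Y))).
  apply: ereal_inf_lbound; exists (glue_space Q), (glue_l Q), (glue_r Q); split=> //.
    by move=> x; rewrite -!rnormE rnorm_glue_l.
  by move=> y; rewrite -!rnormE rnorm_glue_r.
have shrink r : 0 <= r -> r <= 1 -> joint_gap Q * r <= joint_gap Q.
  by move=> r0 r1; rewrite ler_piMr// ltW.
rewrite /hausdorff_dist ge_max; apply/andP; split.
  apply: ge_ereal_sup => _ [_ [x x1 <-] <-]; apply/lee_addgt0Pr => e e0.
  have [x' [y [r [xy r1 xx']]]] := joint_unit_ball_l Q x1 e0.
  apply: (@le_trans _ _ (rnorm (glue_l Q x - glue_r Q y))%:E).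
    apply: ereal_inf_lbound; exists (glue_r Q y) => //; exists y => //.
    exact: le_trans (joint_le_r xy) r1.
  rewrite -EFinD lee_fin.
  have -> : glue_l Q x - glue_r Q y = (glue_l Q x' - glue_r Q y) + glue_l Q (x - x').
    by rewrite linearB/= [RHS]addrC addrA subrK.
  rewrite (le_trans (rnormD _ _))// lerD ?rnorm_glue_l//.
  by rewrite (le_trans (rnorm_glueB xy))// shrink// (joint_ge0 xy).
apply: ge_ereal_sup => _ [_ [y y1 <-] <-]; apply/lee_addgt0Pr => e e0.
have [y' [x [r [xy r1 yy']]]] := joint_unit_ball_l (joint_quotientC Q) y1 e0.
have {}xy : joint Q x y' r := xy.
apply: (@le_trans _ _ (rnorm (glue_l Q x - glue_r Q y))%:E).
  apply: ereal_inf_lbound; exists (glue_l Q x) => //; exists x => //.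
  exact: le_trans (joint_le_l xy) r1.
rewrite -EFinD lee_fin.
have -> : glue_l Q x - glue_r Q y = (glue_l Q x - glue_r Q y') - glue_r Q (y - y').
  by rewrite linearB/= opprB addrA subrK.
rewrite (le_trans (rnormD _ _))// lerD ?rnormN ?rnorm_glue_r//.
by rewrite (le_trans (rnorm_glueB xy))// shrink// (joint_ge0 xy).
Qed.

(** * Comparison of the interpolation spaces *)

Section InterpolationGap.
Variables (R : realType) (XX : seq_couple R).
Implicit Types (a b : int -> sumsp XX).

(** A near-optimal representative [a'] of the value at [s] differs from [a] by a
    series vanishing at [s]. Dividing the difference by [l - cexp s] gives [b], and
    [a' + (cexp t - cexp s) b] represents the value at [t]. *)
Lemma interp_norm_gap (z0 s t : strip R) (C : R) a u0 u1 (r : R) :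
  division_constant XX z0 s C -> laurent_rep a u0 u1 ->
  l2 (rnorm u0) (rnorm u1) <= r ->
  (interp_norm t (laurent a (cexp t)) <=
   interp_norm s (laurent a (cexp s)) + (2 * rnorm (cexp t - cexp s) * C * r)%:E)%E.
Proof.
move=> div au ur; have C0 : 0 < C by case: div.
have ss := stripP s; have st := stripP t.
have as_ := cexp_annulus ss; have at_ := cexp_annulus st.
have Nr : (interp_norm s (laurent a (cexp s)) <= r%:E)%E.
  by rewrite (le_trans (laurent_interp_norm_le ss au))// lee_fin.
have Nf : interp_norm s (laurent a (cexp s)) \is a fin_num.
  by rewrite ge0_fin_numE ?interp_norm_ge0// (le_lt_trans Nr)// ltry.
pose N := fine (interp_norm s (laurent a (cexp s))).
have NE : interp_norm s (laurent a (cexp s)) = N%:E by rewrite fineK.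
rewrite NE lee_fin in Nr; rewrite NE.
pose q := rnorm (cexp t - cexp s); have q0 : 0 <= q := cabs_ge0 _.
apply/lee_addgt0Pr => e e0.
pose e' := e / (1 + q * C).
have qC : 0 < 1 + q * C by rewrite ltr_wpDr// mulr_ge0// ltW.
have e'0 : 0 < e' by rewrite divr_gt0.
have : (interp_norm s (laurent a (cexp s)) < (N + e')%:E)%E by rewrite NE lte_fin ltrDl.
move=> /(laurent_interp_norm_lt ss)[a' [u0' [u1' [au' a'E lt]]]].
rewrite lte_fin in lt.
have aM := laurent_rep_growth au; have aM' := laurent_rep_growth au'.
have du := laurent_repB au au'.
have dE l : annulus l ->
    laurent (fun k => a k - a' k) l = laurent a l - laurent a' l.
  move=> al; apply: (laurentE (laurent_rep_growth du) al).
  apply: has_sum_ext (has_sumB (laurentP aM al) (laurentP aM' al)) => k.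
  by rewrite /laurent_term [RHS]scalerBr.
have [|b [v0 [v1 [bv dbE bC]]]] := division_constant_laurent (stripP z0) ss div du.
  by rewrite dE// a'E subrr.
have bM := laurent_rep_growth bv.
pose c := cexp t - cexp s.
have cv := laurent_repD au' (laurent_repZ c bv).
have cE : laurent (fun k => a' k + c *: b k) (cexp t) = laurent a (cexp t).
  rewrite (laurentD aM' (laurent_rep_growth (laurent_repZ c bv)) at_).
  have -> : laurent (fun k => c *: b k) (cexp t) = laurent a (cexp t) - laurent a' (cexp t).
    exact: etrans (laurentZ c bM at_) (etrans (esym (dbE _ at_)) (dE _ at_)).
  exact: etrans (addrC _ _) (subrK _ _).
rewrite -cE; apply: (le_trans (laurent_interp_norm_le st cv)).
rewrite -!EFinD lee_fin.
have dn : l2 (rnorm (u0 - u0')) (rnorm (u1 - u1')) <= 2 * r + e'.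
  apply: (le_trans (l2_rnormD _ _ _ _)); rewrite !rnormN.
  move: ur lt Nr; lra.
have bn : l2 (rnorm v0) (rnorm v1) <= C * (2 * r + e').
  by rewrite (le_trans bC)// ler_wpM2l// ltW.
apply: (le_trans (l2_rnormD _ _ _ _)); rewrite l2_rnormZ.
apply: (le_trans (lerD (ltW lt) (ler_wpM2l q0 bn))).
have -> : N + e' + q * (C * (2 * r + e')) =
  N + 2 * q * C * r + e' * (1 + q * C) by ring.
by rewrite /e' divfK// gt_eqF.
Qed.

Variables (s t : strip R).

Definition interp_joint (x : interp_sp XX t) (y : interp_sp XX s) (r : R) : Prop :=
  exists a u0 u1, [/\ laurent_rep a u0 u1, laurent a (cexp t) = interp_val x,
    laurent a (cexp s) = interp_val y & l2 (rnorm u0) (rnorm u1) <= r].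

Lemma interp_jointD x y r x' y' r' :
  interp_joint x y r -> interp_joint x' y' r' -> interp_joint (x + x') (y + y') (r + r').
Proof.
move=> [a [u0 [u1 [au ax ay ur]]]] [b [v0 [v1 [bv bx by_ vr]]]].
have aM := laurent_rep_growth au; have bM := laurent_rep_growth bv.
exists (fun k => a k + b k), (u0 + v0), (u1 + v1); split.
- exact: laurent_repD.
- by rewrite (laurentD aM bM (cexp_annulus (stripP t))) ax bx.
- by rewrite (laurentD aM bM (cexp_annulus (stripP s))) ay by_.
- by rewrite (le_trans (l2_rnormD _ _ _ _))// lerD.
Qed.

Lemma interp_jointZ (c : R[i]) x y r :
  interp_joint x y r -> interp_joint (c *: x) (c *: y) (rnorm c * r).
Proof.
move=> [a [u0 [u1 [au ax ay ur]]]]; have aM := laurent_rep_growth au.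
exists (fun k => c *: a k), (c *: u0), (c *: u1); split.
- exact: laurent_repZ.
- by rewrite (laurentZ c aM (cexp_annulus (stripP t))) ax.
- by rewrite (laurentZ c aM (cexp_annulus (stripP s))) ay.
- by rewrite l2_rnormZ ler_wpM2l// cabs_ge0.
Qed.

Lemma laurent_in_interp_pred (z : strip R) a u0 u1 : laurent_rep a u0 u1 ->
  laurent a (cexp z) \in interp_pred z.
Proof.
move=> au; exact: le_lt_trans (laurent_interp_norm_le (stripP z) au) (ltry _).
Qed.

Lemma interp_joint_lift_l x (e : R) : 0 < e ->
  exists y, interp_joint x y (rnorm x + e).
Proof.
move=> e0; have : (interp_norm t (interp_val x) < (rnorm x + e)%:E)%E.
  by rewrite -rnorm_interp lte_fin ltrDl.
move=> /(laurent_interp_norm_lt (stripP t))[a [u0 [u1 [au ax lt]]]].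
exists (InterpSp (laurent_in_interp_pred s au)), a, u0, u1; split=> //.
by rewrite ltW.
Qed.

Lemma interp_joint_lift_r y (e : R) : 0 < e ->
  exists x, interp_joint x y (rnorm y + e).
Proof.
move=> e0; have : (interp_norm s (interp_val y) < (rnorm y + e)%:E)%E.
  by rewrite -rnorm_interp lte_fin ltrDl.
move=> /(laurent_interp_norm_lt (stripP s))[a [u0 [u1 [au ay lt]]]].
exists (InterpSp (laurent_in_interp_pred t au)), a, u0, u1; split=> //.
by rewrite ltW.
Qed.

Lemma interp_joint_le_l x y r : interp_joint x y r -> rnorm x <= r.
Proof.
move=> [a [u0 [u1 [au ax _ ur]]]]; rewrite -lee_fin rnorm_interp -ax.
by rewrite (le_trans (laurent_interp_norm_le (stripP t) au))// lee_fin.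
Qed.

Lemma interp_joint_le_r x y r : interp_joint x y r -> rnorm y <= r.
Proof.
move=> [a [u0 [u1 [au _ ay ur]]]]; rewrite -lee_fin rnorm_interp -ay.
by rewrite (le_trans (laurent_interp_norm_le (stripP s) au))// lee_fin.
Qed.

Variables (z0 : strip R) (Cs Ct : R).
Hypothesis divs : division_constant XX z0 s Cs.
Hypothesis divt : division_constant XX z0 t Ct.
Variable d : R.
Hypothesis d0 : 0 < d.
Hypothesis dC : 2 * rnorm (cexp t - cexp s) * Num.max Cs Ct <= d.

Lemma interp_joint_gap_l x y r : interp_joint x y r -> rnorm x <= rnorm y + d * r.
Proof.
move=> J; have r0 : 0 <= r := le_trans (rnorm_ge0 _) (interp_joint_le_l J).
move: J => [a [u0 [u1 [au ax ay ur]]]].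
have := interp_norm_gap t divs au ur.
rewrite ax ay -(rnorm_interp x) -(rnorm_interp y) -EFinD lee_fin => H.
apply: (le_trans H); rewrite lerD2l.
apply: (ler_wpM2r r0); apply: le_trans dC; apply: ler_wpM2l.
  by apply: mulr_ge0 => //; exact: cabs_ge0.
by rewrite le_max lexx.
Qed.

Lemma interp_joint_gap_r x y r : interp_joint x y r -> rnorm y <= rnorm x + d * r.
Proof.
move=> J; have r0 : 0 <= r := le_trans (rnorm_ge0 _) (interp_joint_le_l J).
move: J => [a [u0 [u1 [au ax ay ur]]]].
have := interp_norm_gap s divt au ur.
rewrite ax ay -(rnorm_interp x) -(rnorm_interp y) -EFinD lee_fin cabsB => H.
apply: (le_trans H); rewrite lerD2l.
apply: (ler_wpM2r r0); apply: le_trans dC; apply: ler_wpM2l.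
  by apply: mulr_ge0 => //; exact: cabs_ge0.
by rewrite le_max lexx orbT.
Qed.

Definition interp_joint_quotient : joint_quotient (interp_sp XX t) (interp_sp XX s) :=
  JointQuotient d0 interp_jointD interp_jointZ interp_joint_lift_l
    interp_joint_lift_r interp_joint_le_l interp_joint_le_r
    interp_joint_gap_l interp_joint_gap_r.

Lemma kadets_dist_interp_le : (kadets_dist (interp_sp XX t) (interp_sp XX s) <= d%:E)%E.
Proof. exact: kadets_dist_joint_quotient interp_joint_quotient. Qed.

End InterpolationGap.

Theorem corollary6p3 (R : realType) (XX : seq_couple R) (z0 s t : strip R)
    (Cs Ct : R) (hCs : division_constant XX z0 s Cs)
    (hCt : division_constant XX z0 t Ct) :
  (kadets_dist (interp_sp XX t) (interp_sp XX s)
     <= (4 * rnorm (cexp t - cexp s) * Num.max Cs Ct)%:E)%E.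
Proof.
have [Cs0 _] := hCs; have q0 : 0 <= rnorm (cexp t - cexp s) := cabs_ge0 _.
have m0 : 0 <= rnorm (cexp t - cexp s) * Num.max Cs Ct.
  by rewrite mulr_ge0// le_max ltW.
apply/lee_addgt0Pr => e e0; rewrite -EFinD.
by apply: (kadets_dist_interp_le hCs hCt); rewrite -!mulrA in m0 *; lra.
Qed.
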